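(* Let $\mathcal{E}$ be an instanton bundle on $X$. Then $h^0(\mathcal{E}(h_i))\le 2$ for $i\in\{1,2,3\}$.
   Context: $X=\mathbb{P}^1\times\mathbb{P}^1\times\mathbb{P}^1$ over $\mathbb{C}$; $h_i$ is the class of the pullback of $\mathcal{O}_{\mathbb{P}^1}(1)$ from the $i$-th factor and $h=h_1+h_2+h_3$ is the polarization. An instanton bundle on $X$ is a rank two vector bundle $\mathcal{E}$, $\mu$-semistable with respect to $h$, with $c_1(\mathcal{E})=0$ and $H^0(\mathcal{E})=H^1(\mathcal{E}(-h))=0$. Here $\mathcal{E}(D)=\mathcal{E}\otimes\mathcal{O}_X(D)$. *)

(* Defs.v *)
From HB Require Import structures.
From mathcomp Require Import all_boot all_order all_fingroup all_algebra.
From mathcomp Require Import mpoly complex reals.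

Set Implicit Arguments.
Unset Strict Implicit.
Unset Printing Implicit Defensive.

Import Order.TTheory GRing.Theory Num.Theory.
Local Open Scope ring_scope.

(* [X = P^1 x P^1 x P^1] over an algebraically closed field [k] is treated as a
   classical variety.  A divisor class [d_1 h_1 + d_2 h_2 + d_3 h_3] is the
   element [d] of [Pic X = Z^3]. *)
Definition cls := {ffun 'I_3 -> int}.

Definition hcl (i : 'I_3) : cls := [ffun j => (j == i)%:Z].
Definition hpol : cls := \sum_(i < 3) hcl i.

(* Intersection product: [h_1 h_2 h_3 = 1] and [h_i ^ 2 = 0]. *)
Definition inter3 (a b c : cls) : int :=
  \sum_(s : 'S_3) a (s (inord 0)) * b (s (inord 1)) * c (s (inord 2)).

Definition slope (d : cls) (r : nat) : rat := (inter3 d hpol hpol)%:~R / r%:R.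

(* Dimension of a subset [A] of a [K]-vector space, stable under linear
   combinations with coefficients in the subfield [L] of [K], over [L]. *)
Definition has_dim (K : fieldType) (V : lmodType K) (L : K -> Prop)
    (A : V -> Prop) (n : nat) : Prop :=
  exists b : 'I_n -> V,
    [/\ forall j, A (b j),
        forall c : 'I_n -> K, (forall j, L (c j)) ->
          \sum_j c j *: b j = 0 -> forall j, c j = 0
      & forall v, A v -> exists2 c : 'I_n -> K,
          forall j, L (c j) & v = \sum_j c j *: b j].

Section Geometry.
Variable k : closedFieldType.

(* Homogeneous coordinate ring of [X] and its fraction field; the variable
   numbered [mxvec_index i a] is the [a]-th coordinate on the [i]-th factor. *)
Notation S := {mpoly k[3 * 2]}.
Notation K := {fraction {mpoly k[3 * 2]}}.
Notation pt := 'M[k]_(3, 2).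

(* A point of [X] is given by homogeneous coordinates: row [i] of the matrix is
   a representative of the component in the [i]-th factor. *)
Definition is_pt (p : pt) : Prop := forall i, row i p != 0.

Definition ev (f : S) (p : pt) : k := f.@[fun j => mxvec p 0 j].

Definition mhomog (d : cls) (f : S) : Prop :=
  forall m, m \in msupp f ->
    forall i : 'I_3, (\sum_(a < 2) m (mxvec_index i a))%:Z = d i.

(* Opens are nonempty throughout, and are represented by their (saturated) sets
   of homogeneous coordinates. *)
Definition is_open (U : pt -> Prop) : Prop :=
  (exists p, U p) /\
  exists T : S -> Prop,
    (forall f, T f -> exists d, mhomog d f) /\
    (forall p, U p <-> is_pt p /\ exists2 f, T f & ev f p != 0).

Definition inc (U V : pt -> Prop) : Prop := forall p, U p -> V p.
Definition cap (U V : pt -> Prop) : pt -> Prop := fun p => U p /\ V p.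
Definition allX : pt -> Prop := is_pt.

(* [X] is integral, so [O_X(d)] is the subsheaf of the constant sheaf of
   rational functions of multidegree [d] whose sections over an open [U] are
   those regular at each point of [U]; restriction maps are inclusions. *)
Definition regular (d : cls) (U : pt -> Prop) (f : K) : Prop :=
  forall p, U p -> exists e : cls, exists a b : S,
    [/\ mhomog (d + e) a, mhomog e b, ev b p != 0 & f = tofrac a / tofrac b].

Definition ratfun (f : K) : Prop :=
  exists e : cls, exists a b : S,
    [/\ mhomog e a, mhomog e b, b != 0 & f = tofrac a / tofrac b].

Definition constant (f : K) : Prop := exists c : k, f = tofrac c%:MP.

(* Rank [n] vector bundles, given by transition functions on a finite Zariski
   open cover. *)
Record vbundle (n : nat) := VBundle {
  idx : finType;
  dom : idx -> pt -> Prop;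
  trans : idx -> idx -> 'M[K]_n;
  dom_open : forall i, is_open (dom i);
  dom_cover : forall p, is_pt p -> exists i, dom i p;
  trans_regular : forall i j a b,
    regular 0 (cap (dom i) (dom j)) (trans i j a b);
  trans_id : forall i, trans i i = 1%:M;
  trans_cocycle : forall i j l, trans i j *m trans j l = trans i l
}.

Section Bundle.
Variables (n : nat) (E : vbundle n).

(* Rational sections of the twists of [E], componentwise in the
   trivialisations. *)
Notation Vect := {ffun idx E -> 'cV[K]_n}.

(* Sections of [E(d) = E (x) O_X(d)] over [U]. *)
Definition sections (d : cls) (U : pt -> Prop) (s : Vect) : Prop :=
  (forall i a, regular d (cap U (dom i)) (s i a 0)) /\
  (forall i j, s i = trans i j *m s j).

Definition h0_eq (d : cls) (m : nat) : Prop :=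
  has_dim constant (sections d allX) m.

Definition H0_zero (d : cls) : Prop :=
  forall s, sections d allX s -> s = 0.

(* The standard affine cover of [X] by eight copies of affine 3-space. *)
Definition chart (c : {ffun 'I_3 -> 'I_2}) (p : pt) : Prop :=
  is_pt p /\ forall i, p i (c i) != 0.

(* Sheaf cohomology is Cech cohomology for this cover. *)
Definition H1_zero (d : cls) : Prop :=
  forall t : {ffun 'I_3 -> 'I_2} -> {ffun 'I_3 -> 'I_2} -> Vect,
    (forall c c', sections d (cap (chart c) (chart c')) (t c c')) ->
    (forall c c' c'', t c c' + t c' c'' = t c c'') ->
    exists2 u : {ffun 'I_3 -> 'I_2} -> Vect,
      forall c, sections d (chart c) (u c) &
      forall c c', t c c' = u c' - u c.

(* [c_1(E) = d], that is, [det E], whose transition functions are the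
   determinants of those of [E], is isomorphic to [O_X(d)]: here [l] is a
   nowhere vanishing section of [det E (x) O_X(-d)]. *)
Definition c1_eq (d : cls) : Prop :=
  exists l : idx E -> K,
    [/\ forall i, regular (- d) (dom i) (l i),
        forall i, l i != 0 /\ regular d (dom i) (l i)^-1
      & forall i j, l i = \det (trans i j) * l j].

(* A coherent subsheaf of [E]: an [O_X]-submodule sheaf of finite type.  Local
   sections that agree on overlaps come from a single rational section, so that
   the sheaf axiom only says that membership is local. *)
Record coh_subsheaf (F : (pt -> Prop) -> Vect -> Prop) : Prop := CohSubsheaf {
  sub_sections : forall U s, is_open U -> F U s -> sections 0 U s;
  sub_zero : forall U, is_open U -> F U 0;
  sub_add : forall U s t, is_open U -> F U s -> F U t -> F U (s + t);
  sub_scale : forall U f s, is_open U -> regular 0 U f -> F U s -> F U (f *: s);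
  sub_restrict : forall U W s, is_open U -> is_open W -> inc W U ->
    F U s -> F W s;
  sub_glue : forall U s, is_open U ->
    (forall p, U p -> exists W, [/\ is_open W, W p, inc W U & F W s]) -> F U s;
  sub_finite_type : forall p, is_pt p ->
    exists W m (t : 'I_m -> Vect),
      [/\ is_open W, W p, forall j, F W (t j) &
        forall U s q, is_open U -> inc U W -> F U s -> U q ->
          exists U' (a : 'I_m -> K),
            [/\ is_open U', U' q, inc U' U, forall j, regular 0 U' (a j)
              & s = \sum_j a j *: t j]]
}.

(* The rank is the dimension of the generic stalk over the function field. *)
Definition sub_rank (F : (pt -> Prop) -> Vect -> Prop) (r : nat) : Prop :=
  has_dim ratfun (fun s : Vect => exists2 U, is_open U & F U s) r.

(* The complement of [V] has codimension at least 2: [V] meets every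
   hypersurface. *)
Definition big_open (V : pt -> Prop) : Prop :=
  is_open V /\
  forall (d : cls) (f : S), mhomog d f -> d != 0 -> f != 0 ->
    exists2 p, V p & ev f p = 0.

(* First Chern class of a torsion free coherent sheaf [F] of rank one:
   [c_1(F) = d] when [F] is isomorphic to [O_X(d)] away from codimension 2. *)
Definition sub_c1 (F : (pt -> Prop) -> Vect -> Prop) (d : cls) : Prop :=
  exists V, exists phi : K -> Vect,
    big_open V /\
    forall U, is_open U -> inc U V ->
      [/\ forall f, regular d U f -> F U (phi f),
          forall a f g, regular 0 U a -> regular d U f -> regular d U g ->
            phi (a * f + g) = a *: phi f + phi g,
          forall f g, regular d U f -> regular d U g -> phi f = phi g -> f = g
        & forall s, F U s -> exists2 f, regular d U f & phi f = s].

End Bundle.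

(* Mu-semistability with respect to [h]; for a bundle of rank 2 the subsheaves
   [F] with [0 < rk F < rk E] are those of rank one. *)
Definition mu_semistable (E : vbundle 2) : Prop :=
  forall F : (pt -> Prop) -> {ffun idx E -> 'cV[K]_2} -> Prop,
    coh_subsheaf F -> sub_rank F 1 ->
    forall d e : cls, sub_c1 F d -> c1_eq E e -> slope d 1 <= slope e 2.

Record instanton (E : vbundle 2) : Prop := Instanton {
  instanton_semistable : mu_semistable E;
  instanton_c1 : c1_eq E 0;
  instanton_H0 : H0_zero E 0;
  instanton_H1 : H1_zero E (- hpol)
}.

End Geometry.

(* Main.v *)
Require Import Defs.
From HB Require Import structures.
From mathcomp Require Import all_boot all_order fingroup perm all_algebra.
From mathcomp Require Import mpoly complex reals boolp.
From mathcomp Require Import zify ring.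

(** Why at most two sections.  Let [x0, x1] be the homogeneous coordinates on
    the [i]-th factor and take three global sections [s1, s2, s3] of [E(h_i)];
    it suffices to find a nontrivial linear relation with constant
    coefficients between them ([sections_dependent]).

    Since [det E] is trivial, the wedge of two sections of [E(h_i)] is a global
    section of [O(2 h_i)], hence a binary quadratic form in [x0, x1]
    ([wedge_sections], [quadratic_form]).  As [E] has rank two, Cramer's
    identity
      [(s2 /\ s3) s1 + (s3 /\ s1) s2 + (s1 /\ s2) s3 = 0]
    holds.  Collecting the coefficients of the three quadratic forms, it reads
      [x0^2 u + x0 x1 v + x1^2 w = 0]
    where [u, v, w] are constant combinations of the [s_j].  Such a relation
    forces [x0] to divide [w], and [w / x0] is then a section of [E], so that
    it is zero because [H^0(E) = 0]; likewise [u = 0], and then [v = 0]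
    ([no_quadratic_relation]).  Either one of these three combinations is a
    nontrivial relation, or all coefficients vanish, that is, the three wedges
    are zero.

    In the latter case the sections are proportional over the function field.
    The Cox ring of [X] is a polynomial ring, so it is factorial, and removing
    common factors gives [s_j = f_j r] with forms [f_j] of one multidegree [d]
    and a nonzero section [r] of [E(h_i - d)] ([common_factor]).  The line
    subsheaf [O(d - h_i)] generated by [r] cannot destabilise [E], so
    [d_1 + d_2 + d_3 <= 1] ([instanton_degree_ge0]).  The forms of such a degree
    are constants, or linear forms on a single factor: a space of dimension at
    most two, in which [f_1, f_2, f_3] are dependent
    ([proportional_dependent]).

    Two facts about the coordinate ring support this: polynomial rings over a
    field are factorial ([mpoly_factorial], by Gauss's lemma), and a form of
    nonzero multidegree over an algebraically closed field vanishes somewhere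
    on [X] ([exists_zero]).  Together they show that a function that is regular
    of degree [d] everywhere on [X] is a form of multidegree [d]
    ([global_regular]). *)

Set Implicit Arguments.
Unset Strict Implicit.
Unset Printing Implicit Defensive.

Import Order.TTheory GRing.Theory Num.Theory.
Local Open Scope ring_scope.

(** * Unique factorization in polynomial rings *)
Section Factorial.
Variable R : idomainType.
Implicit Types (a b p : R) (l : seq R).

Definition divides a b := exists c, b = a * c.

(** Units are admitted along with the primes: a unit then needs no separate
    treatment in factorizations, which become plain products. *)
Definition quasi_prime p :=
  p != 0 /\ forall a b, divides p (a * b) -> divides p a \/ divides p b.

Definition factors_into a l :=
  (forall p, p \in l -> quasi_prime p) /\ a = \prod_(p <- l) p.

Lemma divides_refl a : divides a a.
Proof. by exists 1; rewrite mulr1. Qed.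

Lemma divides_mulr a b c : divides a b -> divides a (b * c).
Proof. by case=> d ->; exists (d * c); rewrite mulrA. Qed.

Lemma unit_divides a b : a \is a GRing.unit -> divides a b.
Proof. by move=> ua; exists (a^-1 * b); rewrite mulrA divrr ?mul1r. Qed.

Lemma unit_quasi_prime a : a \is a GRing.unit -> quasi_prime a.
Proof.
move=> ua; split; first by apply: contraTneq ua => ->; rewrite unitr0.
by move=> *; left; apply: unit_divides.
Qed.

Lemma factors_into_cons p l a : quasi_prime p -> factors_into a l ->
  factors_into (p * a) (p :: l).
Proof.
move=> pp [pl ->]; split; last by rewrite big_cons.
by move=> q; rewrite inE => /predU1P[->|/pl].
Qed.

Lemma factors_into_cons_inv p l a : factors_into a (p :: l) ->
  quasi_prime p /\ exists2 b, a = p * b & factors_into b l.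
Proof.
case=> pl ->; split; first by apply: pl; rewrite mem_head.
exists (\prod_(q <- l) q); first by rewrite big_cons.
by split=> // q ql; apply: pl; rewrite inE ql orbT.
Qed.

Lemma factors_into_cat a b l l' : factors_into a l -> factors_into b l' ->
  factors_into (a * b) (l ++ l').
Proof.
move=> [pl ->] [pl' ->]; split; last by rewrite big_cat.
by move=> p; rewrite mem_cat => /orP[/pl|/pl'].
Qed.

Lemma factors_into_rem p l a : factors_into a l -> p \in l ->
  exists2 b, a = p * b & factors_into b (rem p l).
Proof.
move=> [pl ->] pin; exists (\prod_(q <- rem p l) q).
  by rewrite (perm_big _ (perm_to_rem pin)) big_cons.
by split=> // q /mem_rem /pl.
Qed.

(** Peeling the factors of [a] off [d] or off [e] one by one, [d] loses only
    units unless some nonunit factor of [a] divides it. *)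
Lemma nonunit_factor l a d e : factors_into a l -> a = d * e ->
  d \isn't a GRing.unit ->
  exists2 p, p \in l & p \isn't a GRing.unit /\ divides p d.
Proof.
elim: l a d e => [|p l IH] a d e.
  case=> _ ->; rewrite big_nil => de; case/negP.
  by apply/unitrPr; exists e; rewrite -de.
case/factors_into_cons_inv=> [[p0 pp] [b -> fb]] pb nd.
have pde : divides p (d * e) by exists b.
case: (boolP (p \is a GRing.unit)) => up.
  have [] // := IH b (p^-1 * d) e fb.
  - by rewrite -mulrA -pb mulKr.
  - by rewrite unitrMr ?unitrV.
  move=> q ql [nq qd]; exists q; first by rewrite inE ql orbT.
  split=> //; rewrite -(mulVKr up d) mulrC.
  exact: divides_mulr.
case: (pp _ _ pde) => [pd|[f ef]]; first by exists p; rewrite ?mem_head.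
have [] // := IH b d f fb.
  by apply: (mulfI p0); rewrite pb ef mulrCA.
by move=> q ql [nq qd]; exists q; rewrite // inE ql orbT.
Qed.

End Factorial.

Definition factorial (R : idomainType) :=
  forall a : R, a != 0 -> exists l, factors_into a l.

(** Coprimality in the form in which it is used, cancellation in divisibility. *)
Definition coprime_factor (R : idomainType) (b a : R) :=
  forall x, divides b (a * x) -> divides b x.

(** Induction on the factors of [b]: each one either divides the current
    numerator, and moves to the common factor [g], or stays in [b']. *)
Lemma factorial_lowest_terms (R : idomainType) (a b : R) :
  factorial R -> b != 0 ->
  exists g a' b', [/\ a = g * a', b = g * b' & coprime_factor b' a'].
Proof.
move=> fR b0; have [l] := fR b b0; elim: l b {b0} => [|p l IH] b.
  case=> _ ->; exists 1, a, 1; rewrite big_nil !mul1r; split=> // x _.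
  by exists x; rewrite mul1r.
case/factors_into_cons_inv=> [[p0 pp] [c -> /IH]] [g [a' [c' [-> -> cop]]]].
have [[a'' ea]|npa] := pselect (divides p a').
  exists (p * g), a'', c'; split; rewrite ?ea.
  - by rewrite mulrCA mulrA.
  - by rewrite mulrA.
  by move=> x ca; apply: cop; rewrite ea -mulrA mulrC; apply: divides_mulr.
exists g, a', (p * c'); split; rewrite ?mulrA// ?[p * g]mulrC//.
move=> x [y ey].
have /cop[z ez] : divides c' (a' * x) by exists (p * y); rewrite ey mulrCA mulrA.
have [c0|c0] := eqVneq c' 0.
  by exists 0; rewrite mulr0 ez c0 mul0r.
have /pp[//|[w ew]] : divides p (a' * z).
  by exists y; apply: (mulfI c0); rewrite mulrCA -ez ey mulrCA mulrA.
by exists w; rewrite ez ew mulrCA mulrA.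
Qed.

Lemma factorial_transport (R R' : idomainType)
    (f : {rmorphism R -> R'}) (g : {rmorphism R' -> R}) :
  cancel f g -> cancel g f -> factorial R' -> factorial R.
Proof.
move=> fK gK fR' a a0.
have [|l [pl el]] := fR' (f a).
  by rewrite -(rmorph0 f) (can_eq fK).
exists (map g l); split; last by rewrite big_map -rmorph_prod -el fK.
move=> _ /mapP[p /pl[p0 pp] ->]; split.
  by rewrite -(rmorph0 g) (can_eq gK).
move=> x y [z exy]; have /pp[[w ew]|[w ew]] : divides p (f x * f y).
- by exists (f z); rewrite -rmorphM exy rmorphM /= gK.
- by left; exists (g w); rewrite -rmorphM -ew fK.
by right; exists (g w); rewrite -rmorphM -ew fK.
Qed.

Section Gauss.
Variable R : idomainType.
Implicit Types (c : R) (f g h : {poly R}).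

Lemma divides_polyC c f :
  divides c%:P f <-> forall i, divides c f`_i.
Proof.
split=> [[g ->] i|dc]; first by rewrite coefCM; exists g`_i.
have [q hq] := choice dc.
exists (\poly_(i < size f) q i); apply/polyP=> i.
rewrite coefCM coef_poly; case: ltnP => [_|le]; first exact: hq.
by rewrite mulr0 nth_default.
Qed.

(** Gauss's lemma.  If [c] does not divide the coefficient [i0] of [f], with
    [i0] minimal, the coefficient [i0 + j] of [f * g] shows, by induction on
    [j], that [c] divides the coefficient [j] of [g]. *)
Lemma quasi_prime_polyC c : quasi_prime c -> quasi_prime c%:P.
Proof.
case=> c0 cp; split; first by rewrite polyC_eq0.
move=> f g /divides_polyC dfg.
have [df|nf] := pselect (forall i, divides c f`_i).
  by left; apply/divides_polyC.
right; apply/divides_polyC.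
have [i0 [ni0 mi0]] : exists i, ~ divides c f`_i /\
    forall j, (j < i)%N -> divides c f`_j.
  have /existsNP ex := nf.
  have ex' : exists i, `[< ~ divides c f`_i >].
    by case: ex => i ni; exists i; apply/asboolP.
  case: (ex_minnP ex') => i /asboolP ni mi; exists i; split=> // j ji.
  apply: contrapT => nj; have /mi : `[< ~ divides c f`_j >] by apply/asboolP.
  by rewrite leqNgt ji.
have dsum (I : finType) (P : pred I) (F : I -> R) :
    (forall i, P i -> divides c (F i)) -> divides c (\sum_(i | P i) F i).
  move=> dF; apply: (big_ind (divides c)) => //; first by exists 0; rewrite mulr0.
  by move=> _ _ [x ->] [y ->]; exists (x + y); rewrite mulrDr.
elim/ltn_ind=> j IH.
have := dfg (i0 + j)%N; rewrite coefM.
have lti : (i0 < (i0 + j).+1)%N by rewrite ltnS leq_addr.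
rewrite (bigD1 (Ordinal lti)) //= addKn => -[x ex].
have [y ey] : divides c (\sum_(k < (i0 + j).+1 | k != Ordinal lti)
    f`_k * g`_(i0 + j - k)).
  apply: dsum => k; rewrite -val_eqE /= => neq.
  case: (ltnP k i0) => [/mi0 dk|lek]; first exact: divides_mulr.
  rewrite mulrC; apply: divides_mulr; apply: IH.
  have := ltn_ord k; lia.
have /cp[//|//] : divides c (f`_i0 * g`_j).
by exists (x - y); rewrite mulrBr -ex -ey addrK.
Qed.

Definition primitive f := forall c, divides c%:P f -> c \is a GRing.unit.

(** By Gauss's lemma a factorization of [f] up to a constant, that is, over the
    fraction field, is a factorization over [R] with factors of the same
    degrees. *)
Lemma cancel_primes l f g h :
  (forall p, p \in l -> quasi_prime p) -> (\prod_(p <- l) p) *: f = g * h ->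
  exists g' h', [/\ f = g' * h', size g' = size g & size h' = size h].
Proof.
elim: l g h => [|p l IH] g h pl.
  by rewrite big_nil scale1r => ->; exists g, h.
have p0 : p != 0 by have [] := pl p (mem_head _ _).
have pP : p%:P != 0 by rewrite polyC_eq0.
have pl' q : q \in l -> quasi_prime q by move=> ql; apply: pl; rewrite inE ql orbT.
rewrite big_cons -scalerA -mul_polyC => e.
have [_ pp] := quasi_prime_polyC (pl p (mem_head _ _)).
have /pp[[k ek]|[k ek]] : divides p%:P (g * h).
- by exists ((\prod_(q <- l) q) *: f); rewrite e.
- have [|g' [h' [e1 e2 e3]]] := IH k h pl'.
    by apply: (mulfI pP); rewrite e ek mulrA.
  by exists g', h'; split=> //; rewrite e2 ek mul_polyC size_scale.
- have [|g' [h' [e1 e2 e3]]] := IH g k pl'.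
    by apply: (mulfI pP); rewrite e ek mulrCA.
  by exists g', h'; split=> //; rewrite e3 ek mul_polyC size_scale.
Qed.

(** Divisibility by a primitive polynomial over the fraction field descends to
    [R]. *)
Lemma cancel_primes_primitive l f g h : primitive f ->
  (forall p, p \in l -> quasi_prime p) -> (\prod_(p <- l) p) *: g = f * h ->
  divides f g.
Proof.
move=> prf; elim: l h => [|p l IH] h pl.
  by rewrite big_nil scale1r => ->; exists h.
have p0 : p != 0 by have [] := pl p (mem_head _ _).
have pP : p%:P != 0 by rewrite polyC_eq0.
have pl' q : q \in l -> quasi_prime q by move=> ql; apply: pl; rewrite inE ql orbT.
rewrite big_cons -scalerA -mul_polyC => e.
have [_ pp] := quasi_prime_polyC (pl p (mem_head _ _)).
have /pp ph : divides p%:P (f * h).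
  by exists ((\prod_(q <- l) q) *: g); rewrite e.
have [k ek] : divides p%:P h.
  case: ph => [/prf up|//]; apply: unit_divides.
  by rewrite poly_unitE size_polyC p0 coefC eqxx.
apply: (IH k) => //.
by apply: (mulfI pP); rewrite e ek mulrCA.
Qed.

Hypothesis fR : factorial R.

(** Such an [f] is irreducible over the fraction field by [cancel_primes], where
    Bezout makes it prime; [cancel_primes_primitive] brings this back to [R].
    Pseudo-divisibility [%|] in [{poly R}] is divisibility over the fraction
    field. *)
Lemma unsplittable_quasi_prime f : (1 < size f)%N -> primitive f ->
  (forall g h, f = g * h -> size g = 1%N \/ size h = 1%N) -> quasi_prime f.
Proof.
move=> sf prf nsp; have f0 : f != 0 by rewrite -size_poly_gt0 ltnW.
have cancelE c g h : c != 0 -> c *: g = f * h -> divides f g.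
  by move=> /fR[l [pl ->]]; apply: cancel_primes_primitive.
have irr : irreducible_poly f.
  split=> // q sq /Pdiv.Idomain.dvdpP[[c r] /= c0 e]; rewrite -dvdp_size_eqp; last first.
    by apply/Pdiv.Idomain.dvdpP; exists (c, r).
  have [l [pl el]] := fR c0; rewrite el in e.
  have [g [h [egh sg sh]]] := cancel_primes pl e.
  have g0 : g != 0 by apply: contra_neq f0 => g0; rewrite egh g0 mul0r.
  have h0 : h != 0 by apply: contra_neq f0 => h0; rewrite egh h0 mulr0.
  case: (nsp g h egh) => [s1|s1]; last by rewrite -sh s1 eqxx in sq.
  by rewrite egh size_mul // s1 sh.
split=> // g h [k egh].
have dgh : f %| g * h by rewrite egh dvdp_mulr.
have [/Pdiv.Idomain.dvdpP[[c r] /= c0]|nfg] := boolP (f %| g).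
  by rewrite mulrC => /cancelE; left; auto.
right; have cop : coprimep f g.
  apply: contraNT nfg => /irr/(_ (dvdp_gcdl _ _)) /andP[_ fd].
  exact: dvdp_trans fd (dvdp_gcdr _ _).
move: dgh; rewrite Gauss_dvdpr // => /Pdiv.Idomain.dvdpP[[c r] /= c0].
by rewrite mulrC => /cancelE; auto.
Qed.

Lemma primitive_factors f : f != 0 -> primitive f -> exists l, factors_into f l.
Proof.
move: {2}(size f) (leqnn (size f)) => n; elim: n f => [|n IH] f.
  by rewrite size_poly_leq0 => /eqP ->; rewrite eqxx.
move=> sf f0 prf.
have [s1|s1] := leqP (size f) 1.
  exists [:: f]; split; last by rewrite big_seq1.
  (* A primitive constant is a unit. *)
  move=> p; rewrite inE => /eqP ->; apply: unit_quasi_prime.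
  have ef : f = (f`_0)%:P by apply: size1_polyC.
  have uf : f`_0 \is a GRing.unit.
    by apply: prf; rewrite -ef; apply: divides_refl.
  rewrite ef poly_unitE size_polyC coefC eqxx uf andbT.
  by have -> : f`_0 != 0 by apply: contraTneq uf => ->; rewrite unitr0.
have [[g [h [e sg sh]]]|nsp] := pselect (exists g h,
    [/\ f = g * h, size g != 1%N & size h != 1%N]); last first.
  exists [:: f]; split; last by rewrite big_seq1.
  move=> p; rewrite inE => /eqP ->; apply: unsplittable_quasi_prime => // g h e.
  have [|sg] := eqVneq (size g) 1%N; first by left.
  have [|sh] := eqVneq (size h) 1%N; first by right.
  by case: nsp; exists g, h.
have g0 : g != 0 by apply: contra_neq f0 => g0; rewrite e g0 mul0r.
have h0 : h != 0 by apply: contra_neq f0 => h0; rewrite e h0 mulr0.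
move: sf; rewrite e size_mul // => sf.
have sg0 : (0 < size g)%N by rewrite size_poly_gt0.
have sh0 : (0 < size h)%N by rewrite size_poly_gt0.
have [||l gl] := IH g _ g0; first by lia.
  by move=> c dc; apply: prf; rewrite e; apply: divides_mulr.
have [||l' hl] := IH h _ h0; first by lia.
  by move=> c dc; apply: prf; rewrite e mulrC; apply: divides_mulr.
by exists (l ++ l'); apply: factors_into_cat.
Qed.

(** Induction on the number of prime factors of the leading coefficient: a
    nonunit constant dividing [f] divides it, hence has one of them as a factor,
    which can be removed from [f]. *)
Lemma poly_factorial : factorial {poly R}.
Proof.
move=> f f0; have [l] : exists l, factors_into (lead_coef f) l.
  by apply: fR; rewrite lead_coef_eq0.
move: {2}(size l) (erefl (size l)) => n; elim: n l f f0 => [|n IH] l f f0 sl fl.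
  apply: primitive_factors => // c [g e].
  case: fl; rewrite (size0nil sl) big_nil e => _ lc.
  by apply/unitrPr; exists (lead_coef g); rewrite -lc lead_coefM lead_coefC.
have [prf|nprf] := pselect (primitive f); first exact: primitive_factors.
have /existsNP[c /not_implyP[[g eg] /negP nuc]] := nprf.
have [|p pl [nup [d ed]]] := nonunit_factor (d := c) (e := lead_coef g) fl _ nuc.
  by rewrite eg lead_coefM lead_coefC.
have [b eb fb] := factors_into_rem fl pl.
have [p0 pp] := fl.1 p pl.
have ef : f = p%:P * (d%:P * g) by rewrite eg ed polyCM mulrA.
have elead : lead_coef (d%:P * g) = b.
  by apply: (mulfI p0); rewrite -eb ef [RHS]lead_coefM lead_coefC.
have [|||l' fl'] := IH (rem p l) (d%:P * g).
- by apply: contra_neq f0 => h; rewrite ef h mulr0.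
- by rewrite size_rem // sl.
- by rewrite elead.
exists (p%:P :: l'); rewrite ef; apply: factors_into_cons => //.
exact: quasi_prime_polyC.
Qed.
End Gauss.

Lemma mpoly_rmorph_ext (n : nat) (R A : comRingType)
    (f g : {rmorphism {mpoly R[n]} -> A}) :
  (forall c, f c%:MP = g c%:MP) -> (forall i, f 'X_i = g 'X_i) -> f =1 g.
Proof.
move=> fgC fgX p; rewrite (mpolyE p) !rmorph_sum; apply: eq_bigr => m _.
rewrite -mul_mpolyC !rmorphM fgC; congr (_ * _).
rewrite mpolyXE_id !rmorph_prod; apply: eq_bigr => i _.
by rewrite !rmorphXn fgX.
Qed.

Section MpolyFactorial.
Variable F : fieldType.

Section Step.
Variable n : nat.

Definition unmuni : {poly {mpoly F[n]}} -> {mpoly F[n.+1]} :=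
  horner_eval 'X_ord_max \o map_poly (@mwiden n F).

HB.instance Definition _ := GRing.RMorphism.on unmuni.

Lemma muniX_widen (i : 'I_n) : muni 'X_(widen_ord (leqnSn n) i) =
  ('X_i)%:P :> {poly {mpoly F[n]}}.
Proof.
rewrite muniE msuppX big_seq1 mcoeffX eqxx scale1r mnm1E.
rewrite -mul_polyC -val_eqE /= ltn_eqF // expr0 mulr1; congr ('X_[_])%:P.
by apply/mnmP=> j; rewrite mnmE !mnm1E -!val_eqE.
Qed.

Lemma muniX_max : muni 'X_ord_max = 'X :> {poly {mpoly F[n]}}.
Proof.
rewrite muniE msuppX big_seq1 mcoeffX eqxx scale1r mnm1E eqxx expr1.
rewrite (_ : [multinom _ | _ < _] = 0%MM) ?mpolyX0 ?scale1r//.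
by apply/mnmP=> j; rewrite mnmE mnm0E mnm1E -val_eqE /= gtn_eqF.
Qed.

Lemma muniK : cancel (@muni n F) unmuni.
Proof.
apply: (mpoly_rmorph_ext (f := unmuni \o @muni n F) (g := idfun)) => [c|i] /=.
  rewrite muniC /unmuni /= map_polyC /horner_eval hornerC /=; exact: mwidenC.
case: (unliftP ord_max i) => [j|] ->.
  have -> : lift ord_max j = widen_ord (leqnSn n) j by apply: val_inj; exact: lift_max.
  rewrite muniX_widen /unmuni /= map_polyC /horner_eval hornerC /=.
  by rewrite -mnmwiden1; exact: mwidenX.
by rewrite muniX_max /unmuni /= map_polyX /horner_eval hornerX.
Qed.

Lemma muni_mwiden (p : {mpoly F[n]}) : muni (mwiden p) = p%:P.
Proof.
apply: (mpoly_rmorph_ext (f := @muni n F \o @mwiden n F)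
  (g := (@polyC {mpoly F[n]}))) => [c|i] /=; first by rewrite mwidenC muniC.
by rewrite mwidenX mnmwiden1 muniX_widen.
Qed.

Lemma unmuniK : cancel unmuni (@muni n F).
Proof.
elim/poly_ind => [|p c IH]; first by rewrite !rmorph0.
have -> : unmuni (p * 'X + c%:P) = unmuni p * 'X_ord_max + mwiden c.
  by rewrite rmorphD rmorphM /= /unmuni /= map_polyX map_polyC /horner_eval
    hornerX hornerC.
rewrite (rmorphD (@muni n F)) (rmorphM (@muni n F)) /= IH; congr (_ * _ + _).
  exact: muniX_max.
exact: muni_mwiden.
Qed.

End Step.

Lemma mpoly_factorial n : factorial {mpoly F[n]}.
Proof.
elim: n => [|n IH].
  move=> a a0; exists [:: a]; split; last by rewrite big_seq1.
  move=> _ /predU1P[->|//]; apply: unit_quasi_prime.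
  have ea : a = (a@_0)%:MP.
    apply/mpolyP=> m; rewrite mcoeffC; have -> : m = 0%MM by apply/mnmP; case.
    by rewrite eqxx mulr1.
  apply/unitrPr; exists ((a@_0)^-1)%:MP; rewrite [in X in X * _]ea -mpolyCM.
  by rewrite divff //; apply: contra_neq a0 => h; rewrite ea h mpolyC0.
exact: factorial_transport (@muniK n) (@unmuniK n) (poly_factorial IH).
Qed.
End MpolyFactorial.

(** * Factors of homogeneous polynomials *)
(** If neither factor vanishes at [0] then the product does not, so [d = 0] and
    both are constant; otherwise ['X] can be cancelled. *)
Lemma factor_of_monomial (R : idomainType) (p q : {poly R}) c d :
  c != 0 -> p * q = c *: 'X^d -> exists a e, p = a *: 'X^e.
Proof.
have X0 : 'X != 0 :> {poly R} by rewrite polyX_eq0.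
move=> c0; elim: d p q => [|d IH] p q epq.
  have pq0 : p * q != 0 by rewrite epq expr0 alg_polyC polyC_eq0.
  have [p0 q0] : p != 0 /\ q != 0 by apply/andP; rewrite -negb_or -mulf_eq0.
  exists p`_0, 0%N; rewrite expr0 alg_polyC; apply: size1_polyC.
  have := congr1 (fun r : {poly R} => size r) epq.
  rewrite size_mul // expr0 alg_polyC size_polyC c0 /=.
  move: q0; rewrite -size_poly_gt0; case: (size q) => //= k _; rewrite addnS /=.
  by move=> <-; rewrite leq_addr.
have XU (r : {poly R}) : r.[0] = 0 -> exists r', r = 'X * r'.
  move=> /eqP/factor_theorem[r' er]; exists r'.
  by rewrite mulrC er subr0.
have : p.[0] * q.[0] = 0 by rewrite -hornerM epq hornerZ hornerXn expr0n mulr0.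
move/eqP; rewrite mulf_eq0 => /orP[] /eqP /XU[r er].
  have [|a [e ea]] := IH r q.
    by apply: (mulfI X0); rewrite mulrA -er epq exprS scalerAr.
  by exists a, e.+1; rewrite er ea exprS scalerAr.
apply: (IH p r).
by apply: (mulfI X0); rewrite mulrCA -er epq exprS scalerAr.
Qed.

Section Homogeneity.
Variables (R : idomainType) (n : nat) (mf : measure n).
Implicit Types p q : {mpoly R[n]}.

(** The substitution [x_i := x_i T^(weight of x_i)], which turns homogeneity
    into the condition of being a monomial in [T]. *)
Definition dilate p : {poly {mpoly R[n]}} :=
  mmap (@polyC {mpoly R[n]} \o @mpolyC n R)
       (fun i => 'X_i *: 'X^(mf U_(i))%MM) p.

Lemma dilateE p :
  dilate p = \sum_(m <- msupp p) (p@_m *: 'X_[m]) *: 'X^(mf m).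
Proof.
apply: eq_bigr => m _ /=.
have -> : mmap1 (fun i => 'X_i *: 'X^(mf U_(i))%MM) m =
    'X_[m] *: 'X^(mf m) :> {poly {mpoly R[n]}}.
  rewrite /mmap1 mpolyXE_id [mf m]mfE.
  elim/big_rec3: _ => [|i a x y _ ->]; first by rewrite expr0 scale1r.
  rewrite exprZn -scalerAl -scalerAr scalerA -exprM -exprD mulnC.
  by congr (_ *: 'X^_); lia.
by rewrite mul_polyC scalerA mul_mpolyC.
Qed.

Lemma coef_dilate p d m : (dilate p)`_d@_m = if mf m == d then p@_m else 0.
Proof.
rewrite dilateE coef_sum raddf_sum /=.
under eq_bigr => m' _ do rewrite coefZ coefXn.
have [min|nm] := boolP (m \in msupp p); last first.
  rewrite big_seq big1 ?(memN_msupp_eq0 nm) ?if_same // => m' m'in.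
  case: eqP => _; rewrite ?mulr0 ?mcoeff0// mulr1 mcoeffZ mcoeffX.
  by case: eqP nm => [<-|]; rewrite ?m'in ?mulr0.
rewrite (bigD1_seq m) //= ?msupp_uniq // big1 ?addr0; last first.
  move=> m' ne; case: eqP => _; rewrite ?mulr0 ?mcoeff0// mulr1 mcoeffZ mcoeffX.
  by rewrite (negbTE ne) mulr0.
rewrite eq_sym; case: eqP => _; rewrite ?mulr0 ?mcoeff0// mulr1 mcoeffZ mcoeffX.
by rewrite eqxx mulr1.
Qed.

Lemma dhomog_dilate p d : p \is d.-homog for mf -> dilate p = p *: 'X^d.
Proof.
move=> hp; apply/polyP=> i; apply/mpolyP=> m.
rewrite coef_dilate coefZ coefXn; case: (i =P d) => [->|ne].
  rewrite mulr1; case: eqP => // /eqP ne.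
  by rewrite (dhomog_nemf_coeff hp ne).
rewrite mulr0 mcoeff0; case: eqP => // em.
by rewrite (dhomog_nemf_coeff hp) // em; apply/eqP.
Qed.

Lemma dilate_dhomog p a d : dilate p = a *: 'X^d -> p \is d.-homog for mf.
Proof.
move=> e; apply/dhomogP => m; rewrite mcoeff_msupp; apply: contra_neq_eq => ne.
have := coef_dilate p (mf m) m; rewrite eqxx => <-.
by rewrite e coefZ coefXn (negbTE ne) mulr0 mcoeff0.
Qed.

(** Dilation is multiplicative, and a factor of a monomial in [T] is one. *)
Lemma dhomog_factor p q d : p * q != 0 -> p * q \is d.-homog for mf ->
  exists e, p \is e.-homog for mf.
Proof.
move=> pq0 /dhomog_dilate e.
have dM : dilate (p * q) = dilate p * dilate q.
  exact: (rmorphM (mmap (@polyC {mpoly R[n]} \o @mpolyC n R) _)).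
rewrite dM in e; have [a [k ea]] := factor_of_monomial pq0 e.
by exists k; apply: dilate_dhomog ea.
Qed.
End Homogeneity.

(** * The multigraded coordinate ring and zeros of forms *)
Definition rowdeg (i : 'I_3) (m : 'X_{1..3 * 2}) : nat :=
  \sum_(a < 2) m (mxvec_index i a).

Lemma rowdeg0 i : rowdeg i 0%MM = 0%N.
Proof. by rewrite /rowdeg big1 // => a _; rewrite mnm0E. Qed.

Lemma rowdegD i : {morph rowdeg i : m1 m2 / (m1 + m2)%MM >-> (m1 + m2)%N}.
Proof.
by move=> m1 m2; rewrite -big_split; apply: eq_bigr => a _; rewrite mnmDE.
Qed.

HB.instance Definition _ i :=
  isMeasure.Build (3 * 2)%N (rowdeg i) (rowdeg0 i) (rowdegD i).

Lemma mxvec_index_eq m n (i i' : 'I_m) (j j' : 'I_n) :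
  (mxvec_index i j == mxvec_index i' j') = (i == i') && (j == j').
Proof.
apply/eqP/andP => [e|[/eqP -> /eqP ->]] //.
have [g gK _] := curry_mxvec_bij m n.
have gE x y : g (mxvec_index x y) = (x, y) by apply: (gK (x, y)).
by have := congr1 g e; rewrite !gE => -[-> ->].
Qed.

Lemma rowdegU i j a : rowdeg i U_(mxvec_index j a) = (i == j).
Proof.
rewrite /rowdeg (eq_bigr (fun b => ((j == i) && (a == b) : nat))); last first.
  by move=> b _; rewrite mnm1E mxvec_index_eq.
rewrite (bigD1 a) //= eqxx andbT big1 ?addn0 1?eq_sym// => b ne.
by rewrite [a == b]eq_sym (negbTE ne) andbF.
Qed.

Section Multigrading.
Variable k : closedFieldType.
Notation S := {mpoly k[3 * 2]}.
Implicit Types (d e : cls) (f g : S).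

Lemma mhomog_dhomog d f : f != 0 -> mhomog d f <->
  forall i, exists2 n : nat, d i = n & f \is n.-homog for (rowdeg i).
Proof.
move=> f0; split=> [h i|h m ms i].
  exists (rowdeg i (mlead f)); first by rewrite -(h _ (mlead_supp f0) i).
  apply/dhomogP => m ms; apply/eqP; rewrite -eqz_nat; apply/eqP.
  by rewrite (h m ms) (h _ (mlead_supp f0)).
by have [n -> /dhomogP/(_ m ms) <-] := h i.
Qed.

Lemma mhomog0 d : mhomog d (0 : S).
Proof. by move=> m; rewrite msupp0. Qed.

Lemma mhomogC (c : k) : mhomog 0 (c%:MP : S).
Proof.
move=> m; rewrite msuppC; case: eqP => // _; rewrite inE => /eqP -> i.
by rewrite ffunE; exact: (congr1 Posz (rowdeg0 i)).
Qed.

Lemma mhomogX i a : mhomog (hcl i) ('X_(mxvec_index i a) : S).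
Proof.
move=> m /mem_msuppXP <- j; rewrite ffunE; exact: (congr1 Posz (rowdegU _ _ _)).
Qed.

Lemma mhomogD d f g : mhomog d f -> mhomog d g -> mhomog d (f + g).
Proof.
by move=> hf hg m /msuppD_le; rewrite mem_cat => /orP[/hf|/hg].
Qed.

Lemma mhomogZ d c f : mhomog d f -> mhomog d (c *: f).
Proof. by move=> hf m /msuppZ_le /hf. Qed.

Lemma mhomogN d f : mhomog d f -> mhomog d (- f).
Proof. by move=> hf m; rewrite (perm_mem (msuppN _)) => /hf. Qed.

Lemma mhomogM d e f g : mhomog d f -> mhomog e g -> mhomog (d + e) (f * g).
Proof.
move=> hf hg m /msuppM_le/allpairsP[[m1 m2] [/= /hf h1 /hg h2 ->]] i.
rewrite ffunE -h1 -h2 -PoszD; congr Posz; exact: rowdegD.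
Qed.

Lemma mhomog_uniq d e f : f != 0 -> mhomog d f -> mhomog e f -> d = e.
Proof.
move=> f0 hd he; apply/ffunP=> i.
by rewrite -(hd _ (mlead_supp f0)) -(he _ (mlead_supp f0)).
Qed.

Lemma mhomog_ge0 d f i : f != 0 -> mhomog d f -> 0 <= d i.
Proof. by move=> f0 hd; rewrite -(hd _ (mlead_supp f0)). Qed.

Lemma mhomog_factor d f g : f * g != 0 -> mhomog d (f * g) ->
  exists e, mhomog e f /\ mhomog (d - e) g.
Proof.
move=> fg0 hfg; have [f0 g0] : f != 0 /\ g != 0.
  by apply/andP; rewrite -negb_or -mulf_eq0.
have key (p q : S) : p * q != 0 -> mhomog d (p * q) -> exists e, mhomog e p.
  move=> pq0 hpq; have p0 : p != 0 by apply: contra_neq pq0 => ->; rewrite mul0r.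
  have hx i : exists n, p \is n.-homog for (rowdeg i).
    have [n _ hn] := (mhomog_dhomog _ pq0).1 hpq i.
    exact: dhomog_factor pq0 hn.
  have [n hn] := choice hx.
  exists [ffun i => (n i)%:Z]; apply/mhomog_dhomog => // i.
  by exists (n i); rewrite ?ffunE.
have [e he] := key f g fg0 hfg.
have [e' he'] : exists e', mhomog e' g by apply: (key g f); rewrite mulrC.
exists e; split=> //; have -> // : d - e = e'.
by rewrite (mhomog_uniq fg0 hfg (mhomogM he he')) addrC addKr.
Qed.

Lemma mhomog_const f : mhomog 0 f -> exists c, f = c%:MP.
Proof.
move=> hf; exists f@_0; apply/mpolyP=> m; rewrite mcoeffC.
case: eqP => [<-|ne]; first by rewrite mulr1.
rewrite mulr0; apply: memN_msupp_eq0; apply/negP=> ms; apply: ne.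
apply/mnmP=> j; rewrite mnm0E; case/mxvec_indexP: j => i a.
have := hf m ms i; rewrite ffunE => -[] /eqP.
by rewrite sum_nat_eq0 => /forallP/(_ a)/eqP ->.
Qed.

Lemma evM f g (p : 'M[k]_(3, 2)) : ev (f * g) p = ev f p * ev g p.
Proof. exact: mevalM. Qed.

Lemma evX i a (p : 'M[k]_(3, 2)) : ev 'X_(mxvec_index i a) p = p i a.
Proof. by rewrite /ev mevalXU mxvecE. Qed.

Lemma ev_scale_row d f (p : 'M[k]_(3, 2)) j (s : k) n : mhomog d f -> d j = n%:Z ->
  ev f (\matrix_(i, a) ((if i == j then s else 1) * p i a)) = s ^+ n * ev f p.
Proof.
move=> hf dn; rewrite /ev !mevalE mulr_sumr big_seq [RHS]big_seq.
apply: eq_bigr => m ms; rewrite mulrCA; congr (_ * _).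
have re (F : 'I_(3 * 2) -> k) :
    \prod_j F j = \prod_i \prod_a F (mxvec_index i a).
  rewrite pair_bigA /= (reindex _ (curry_mxvec_bij 3 2)) /=.
  by apply: eq_bigr => -[i a].
rewrite !re (bigD1 j) //= [in RHS](bigD1 j) //= mulrA; congr (_ * _); last first.
  apply: eq_bigr => i ne; apply: eq_bigr => a _.
  by rewrite !mxvecE mxE (negbTE ne) mul1r.
have -> : n = (\sum_(a < 2) m (mxvec_index j a))%N.
  by apply/eqP; rewrite -eqz_nat -dn (hf m ms).
rewrite -prodrXr -big_split; apply: eq_bigr => a _ /=.
by rewrite !mxvecE mxE eqxx exprMn.
Qed.

Definition line_restriction (p v : 'M[k]_(3, 2)) f : {poly k} :=
  mmap (@polyC k) (fun l => (mxvec p 0 l)%:P + (mxvec v 0 l) *: 'X) f.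

Lemma horner_line_restriction p v f t :
  (line_restriction p v f).[t] = ev f (p + t *: v).
Proof.
rewrite /line_restriction /ev mevalE /mmap horner_sum; apply: eq_bigr => m _.
rewrite hornerM hornerC /mmap1 horner_prod; congr (_ * _).
apply: eq_bigr => l _; rewrite horner_exp hornerD hornerC hornerZ hornerX.
by rewrite linearD linearZ !mxE mulrC.
Qed.

Lemma exists_non_root_of_unity n : (0 < n)%N ->
  exists2 s : k, s != 0 & s ^+ n != 1.
Proof.
move=> n0; (* A root [s] satisfies [s * (s ^+ n - 1) = -1]. *)
pose q : {poly k} := 'X^(n.+1) - 'X + 1.
have /closed_rootP[s] : size q != 1%N.
  rewrite /q -addrA size_polyDl size_polyXn //.
  apply: leq_ltn_trans (size_polyD _ _) _.
  by rewrite size_polyN size_polyX size_poly1 !ltnS.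
rewrite /root !hornerE exprS => /eqP es.
exists s; first by apply: contra_eq_neq es => ->; rewrite mul0r subr0 add0r oner_eq0.
apply: contra_eq_neq es => ->; rewrite mulr1 subrr add0r; exact: oner_neq0.
Qed.

Lemma is_pt1 : is_pt (const_mx 1 : 'M[k]_(3, 2)).
Proof.
by move=> i; apply/eqP => /rowP/(_ 0); rewrite !mxE => /eqP; rewrite oner_eq0.
Qed.

(** On the binary forms obtained by fixing all coordinates but those of a factor
    in which the degree [n] of [f] is positive, absence of zeros would make
    both dehomogenizations [f (1, t)] and [f (t, 1)] constant, hence equal to
    [f (1, 1)]; by homogeneity [f (s, 1) = s ^ n f (1, 1 / s)], which is absurd
    when [s ^ n] is not [1]. *)
Lemma exists_zero d f : mhomog d f -> d != 0 -> exists2 p, is_pt p & ev f p = 0.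
Proof.
move=> hf d0.
have [->|f0] := eqVneq f 0.
  by exists (const_mx 1); [exact: is_pt1|rewrite /ev meval0].
have [j dj] : exists j, d j != 0.
  apply/not_existsP => h; case/eqP: d0; apply/ffunP=> j; rewrite ffunE.
  by have /negP := h j; rewrite negbK => /eqP.
have [n n0 dn] : exists2 n : nat, (0 < n)%N & d j = n.
  by have := mhomog_ge0 j f0 hf; case: (d j) dj => // n n0 _; exists n; rewrite // lt0n.
apply: contrapT => nz.
pose pnt (x y : k) : 'M[k]_(3, 2) :=
  \matrix_(i, a) if i == j then (if a == 0 then x else y) else 1.
have ptP x y : (x != 0) || (y != 0) -> is_pt (pnt x y).
  move=> xy i; apply/eqP => /rowP e; have := e 0; have := e 1; rewrite !mxE.
  case: eqP => _ /=; last by move=> /eqP; rewrite oner_eq0.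
  by move=> y0 x0; rewrite x0 y0 eqxx in xy.
have nzP x y : (x != 0) || (y != 0) -> ev f (pnt x y) != 0.
  by move=> /ptP pp; apply/eqP => e; apply: nz; exists (pnt x y).
have constP (g : k -> k * k) p v : (forall t, p + t *: v = pnt (g t).1 (g t).2) ->
    (forall t, (g t).1 != 0 \/ (g t).2 != 0) ->
    forall t t', ev f (pnt (g t).1 (g t).2) = ev f (pnt (g t').1 (g t').2).
  move=> gE gn; have /size_poly1P[c _ ec] : size (line_restriction p v f) == 1%N.
    apply: contrapT => /negP/closed_rootP[t /rootP].
    rewrite horner_line_restriction gE; apply/eqP/nzP/orP; exact: gn.
  by move=> t t'; rewrite -!gE -!horner_line_restriction ec !hornerC.
have e1 t : ev f (pnt 1 t) = ev f (pnt 1 1).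
  apply: (constP (fun t => (1, t)) (pnt 1 0) (\matrix_(i, a) ((i == j) && (a == 1))%:R)).
    move=> {}t; apply/matrixP => i a; rewrite !mxE; case: eqP => //= _.
      by case: (a) => [[|[|]]] //= lt; rewrite ?mulr0 ?addr0 ?mulr1 ?add0r.
    by rewrite mulr0 addr0.
  by left; apply: oner_neq0.
have e2 t : ev f (pnt t 1) = ev f (pnt 1 1).
  apply: (constP (fun t => (t, 1)) (pnt 0 1) (\matrix_(i, a) ((i == j) && (a == 0))%:R)).
    move=> {}t; apply/matrixP => i a; rewrite !mxE; case: eqP => //= _.
      by case: (a) => [[|[|]]] //= lt; rewrite ?mulr0 ?addr0 ?mulr1 ?add0r.
    by rewrite mulr0 addr0.
  by right; apply: oner_neq0.
have [s s0 sn] := exists_non_root_of_unity n0.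
have es : pnt s 1 = \matrix_(i, a) ((if i == j then s else 1) * pnt 1 s^-1 i a).
  apply/matrixP => i a; rewrite !mxE; case: eqP => // _; last by rewrite mulr1.
  by case: eqP => _; rewrite ?mulr1 ?divff.
case/eqP: sn; apply: (mulIf (nzP 1 1 _)); first by rewrite oner_neq0.
by rewrite mul1r -{2}(e2 s) es (ev_scale_row _ _ hf dn) e1.
Qed.
End Multigrading.

(** * Regular functions and sections *)
Section RationalFunctions.
Variable k : closedFieldType.
Notation S := {mpoly k[3 * 2]}.
Notation K := {fraction {mpoly k[3 * 2]}}.
Notation pt := 'M[k]_(3, 2).
Implicit Types (c d e : cls) (f g : K) (a b : S) (p : pt).

Definition regular_at d p f : Prop := exists e : cls, exists a b : S,
  [/\ mhomog (d + e) a, mhomog e b, ev b p != 0 & f = tofrac a / tofrac b].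

Definition homog_fraction d f : Prop := exists e : cls, exists a b : S,
  [/\ mhomog (d + e) a, mhomog e b, b != 0 & f = tofrac a / tofrac b].

Lemma ev_neq0 b p : ev b p != 0 -> b != 0.
Proof. by apply: contra_neq => ->; rewrite /ev meval0. Qed.

Lemma regular_at_homog_fraction d p f : regular_at d p f -> homog_fraction d f.
Proof.
by move=> [e [a [b [ha hb /ev_neq0 b0 ->]]]]; exists e, a, b.
Qed.

Lemma regular_at_poly d p a : mhomog d a -> regular_at d p (tofrac a).
Proof.
move=> ha; exists 0, a, 1; split; rewrite ?addr0 ?rmorph1 ?divr1 //.
  by rewrite -mpolyC1; apply: mhomogC.
by rewrite /ev meval1 oner_neq0.
Qed.

Lemma regular_at0 d p : regular_at d p 0.
Proof. by rewrite -(rmorph0 (@tofrac S)); apply/regular_at_poly/mhomog0. Qed.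

Lemma regular_at_inv d p b : mhomog d b -> ev b p != 0 ->
  regular_at (- d) p (tofrac b)^-1.
Proof.
move=> hb b0; exists d, 1, b; split; rewrite ?addNr ?rmorph1 ?mul1r //.
by rewrite -mpolyC1; apply: mhomogC.
Qed.

Lemma regular_atM d e p f g : regular_at d p f -> regular_at e p g ->
  regular_at (d + e) p (f * g).
Proof.
move=> [d' [a [b [ha hb b0 ->]]]] [e' [a' [b' [ha' hb' b0' ->]]]].
exists (d' + e'), (a * a'), (b * b'); split; last by rewrite !rmorphM mulf_div.
- by rewrite addrACA; apply: mhomogM.
- exact: mhomogM.
- by rewrite evM mulf_neq0.
Qed.

Lemma regular_atD d p f g : regular_at d p f -> regular_at d p g ->
  regular_at d p (f + g).
Proof.
move=> [d' [a [b [ha hb b0 ->]]]] [e' [a' [b' [ha' hb' b0' ->]]]].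
exists (d' + e'), (a * b' + a' * b), (b * b'); split.
- apply: mhomogD; first by rewrite addrA; apply: mhomogM.
  by rewrite [d' + e']addrC addrA; apply: mhomogM.
- exact: mhomogM.
- by rewrite evM mulf_neq0.
have [/ev_neq0 nb /ev_neq0 nb'] := (b0, b0').
by rewrite rmorphD !rmorphM /= addf_div ?tofrac_eq0.
Qed.

Lemma regular_atN d p f : regular_at d p f -> regular_at d p (- f).
Proof.
by move=> [e [a [b [/mhomogN ha hb b0 ->]]]]; exists e, (- a), b;
  split=> //; rewrite rmorphN mulNr.
Qed.

Lemma mhomog_cancel d e a b : b != 0 -> mhomog e b -> mhomog d (b * a) ->
  mhomog (d - e) a.
Proof.
move=> b0 hb hba; have [->|a0] := eqVneq a 0; first exact: mhomog0.
have [|e' [hb' ha]] := mhomog_factor _ hba; first by rewrite mulf_neq0.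
by rewrite (mhomog_uniq b0 hb hb').
Qed.

Lemma fraction_lowest_terms d f : homog_fraction d f -> exists e a b,
  [/\ mhomog (d + e) a, mhomog e b, b != 0, f = tofrac a / tofrac b
    & coprime_factor b a].
Proof.
move=> [e [a [b [ha hb b0 ->]]]].
have [g [a' [b' [ea eb cop]]]] := factorial_lowest_terms a (@mpoly_factorial _ _) b0.
have [g0 b0'] : g != 0 /\ b' != 0.
  by apply/andP; rewrite -negb_or -mulf_eq0 -eb.
rewrite eb in hb b0; have [e' [hg hb']] := mhomog_factor b0 hb.
exists (e - e'), a', b'; split=> //.
  by rewrite addrA; apply: mhomog_cancel g0 hg _; rewrite -ea.
by rewrite ea eb !rmorphM -mulf_div divff ?mul1r ?tofrac_eq0.
Qed.

(** The reduced denominator divides every other denominator. *)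
Lemma regular_at_lowest_terms d p a b : b != 0 -> coprime_factor b a ->
  regular_at d p (tofrac a / tofrac b) -> ev b p != 0.
Proof.
move=> b0 cop [e [a' [b' [_ _ b0' /eqP]]]].
rewrite eqr_div ?tofrac_eq0 ?(ev_neq0 b0') // -!rmorphM tofrac_eq => /eqP eab.
have [|c ec] := cop b'; first by exists a'; rewrite eab mulrC.
by apply: contra_neq b0' => h; rewrite ec evM h mul0r.
Qed.

(** The reduced denominator has no zero on [X], hence it has degree zero. *)
Lemma global_regular d f : regular d (@allX k) f ->
  exists2 a, mhomog d a & f = tofrac a.
Proof.
move=> rf; have [e [a [b [ha hb b0 ef cop]]]] :=
  fraction_lowest_terms (regular_at_homog_fraction (rf _ (@is_pt1 k))).
have e0 : e = 0.
  apply: contrapT => /eqP /(exists_zero hb)[p pp]; apply/eqP.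
  by apply: (regular_at_lowest_terms b0 cop); rewrite -ef; apply: rf pp.
rewrite e0 addr0 in ha hb; have [c eb] := mhomog_const hb.
have c0 : c != 0 by apply: contra_neq b0 => c0; rewrite eb c0 mpolyC0.
exists (c^-1 *: a); first exact: mhomogZ.
rewrite ef eb -mul_mpolyC rmorphM mulrC; congr (_ * _).
apply: (mulIf (_ : tofrac c%:MP != 0)); first by rewrite tofrac_eq0 -eb.
by rewrite mulVf ?tofrac_eq0 -?eb // eb -rmorphM -mpolyCM mulVf.
Qed.

(** If [f] and [a f / b] are regular, with [a / b] in lowest terms, then [b]
    divides [f] locally: near [p], up to invertible factors, [b] divides [a f],
    and it is coprime to [a]. *)
Lemma regular_at_divide c c' e p a b f :
  mhomog e b -> b != 0 -> coprime_factor b a ->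
  regular_at c p f -> regular_at c' p (tofrac a / tofrac b * f) ->
  regular_at (c - e) p ((tofrac b)^-1 * f).
Proof.
move=> hb b0 cop [e1 [A [B [hA hB B0 ->]]]] [e2 [C [D [hC hD D0]]]].
have [/ev_neq0 nB /ev_neq0 nD] := (B0, D0).
rewrite mulf_div => /eqP; rewrite eqr_div ?mulf_neq0 ?tofrac_eq0 //.
rewrite -!rmorphM tofrac_eq => /eqP eq.
have [|q eq'] := cop (A * D); first by exists (C * B); rewrite mulrA eq mulrCA.
have hq : mhomog (c - e + (e1 + e2)) q.
  rewrite addrAC; apply: mhomog_cancel b0 hb _; rewrite -eq' addrA.
  exact: mhomogM.
exists (e1 + e2), q, (B * D); split=> //; first exact: mhomogM.
  by rewrite evM mulf_neq0.
apply/eqP; rewrite mulrA [_^-1 * _]mulrC -mulrA -invfM.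
rewrite eqr_div ?mulf_neq0 ?tofrac_eq0 //; last by rewrite mulf_neq0.
by rewrite -!rmorphM tofrac_eq mulrCA eq'; apply/eqP; ring.
Qed.

Lemma homog_fraction_div d e f g : homog_fraction d f -> homog_fraction e g ->
  g != 0 -> homog_fraction (d - e) (f / g).
Proof.
move=> [d' [a [b [ha hb b0 ->]]]] [e' [a' [b' [ha' hb' b0' ->]]]] g0.
have a0' : a' != 0.
  by apply: contra_neq g0 => ->; rewrite rmorph0 mul0r.
exists (d' + (e + e')), (a * b'), (b * a'); split.
- rewrite (_ : _ + _ = d + d' + e'); first exact: mhomogM.
  by apply/ffunP=> i; rewrite !ffunE; ring.
- exact: mhomogM.
- by rewrite mulf_neq0.
by rewrite !rmorphM /= invf_div mulf_div.
Qed.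

End RationalFunctions.

Section Sections.
Variable k : closedFieldType.
Notation S := {mpoly k[3 * 2]}.
Notation K := {fraction {mpoly k[3 * 2]}}.
Notation pt := 'M[k]_(3, 2).
Variables (n : nat) (E : vbundle k n).
Notation Vect := {ffun idx E -> 'cV[K]_n}.
Implicit Types (c d e : cls) (s t r u : Vect) (U : pt -> Prop).

Lemma sectionsD d U s t : sections d U s -> sections d U t -> sections d U (s + t).
Proof.
move=> [rs es] [rt et]; split=> [i a p Up|i j].
  by rewrite ffunE mxE; apply: regular_atD; [apply: rs|apply: rt].
by rewrite !ffunE (es i j) (et i j) mulmxDr.
Qed.

Lemma sectionsZ d e U f s :
  (forall i, regular d (cap U (@dom k n E i)) f) -> sections e U s ->
  sections (d + e) U (f *: s).
Proof.
move=> rf [rs ts]; split=> [i a p Up|i j].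
  by rewrite ffunE mxE; apply: regular_atM; [apply: rf Up|apply: rs].
by rewrite !ffunE (ts i j) scalemxAr.
Qed.

Lemma sections_polyZ d e U a s : mhomog d a -> sections e U s ->
  sections (d + e) U (tofrac a *: s).
Proof. by move=> ha; apply: sectionsZ => i p _; apply: regular_at_poly. Qed.

Lemma sections_constZ d U (c : k) s : sections d U s ->
  sections d U (tofrac c%:MP *: s).
Proof.
by move=> hs; rewrite -[d]add0r; apply: sections_polyZ => //; apply: mhomogC.
Qed.

Lemma dom_point (i : idx E) : exists2 p, is_pt p & dom i p.
Proof.
have [[p dp] [T [_ /(_ p)/iffLR/(_ dp)[pp _]]]] := dom_open i.
by exists p.
Qed.

(** Two proportional sections are multiples of a single one: if [a / b] is the
    ratio in lowest terms, this is [r / b], which is regular by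
    [regular_at_divide]. *)
Lemma common_factor c c' r u f :
  sections c (@allX k) r -> r != 0 -> sections c' (@allX k) u -> u = f *: r ->
  exists e a b r', [/\ mhomog e b, mhomog (c' - c + e) a,
    sections (c - e) (@allX k) r', r = tofrac b *: r' & u = tofrac a *: r'].
Proof.
move=> hr r0 hu eu.
have [i [a ria]] : exists i a, r i a 0 != 0.
  apply: contrapT => h; case/eqP: r0; apply/ffunP=> i; apply/colP=> a.
  rewrite ffunE mxE; apply/eqP; apply: contrapT => /negP ria.
  by apply: h; exists i, a.
have [p pp dp] := dom_point i.
have ef : f = u i a 0 / r i a 0 by rewrite eu !ffunE !mxE mulfK.
have hf : homog_fraction (c' - c) f.
  rewrite ef; apply: homog_fraction_div => //;
    apply: regular_at_homog_fraction; [apply: hu.1|apply: hr.1]; exact: (conj pp dp).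
have [e [x [y [hx hy y0 ef' cop]]]] := fraction_lowest_terms hf.
have yF : tofrac y != 0 by rewrite tofrac_eq0.
exists e, x, y, ((tofrac y)^-1 *: r); split=> //.
- split=> [j b q Uq|j l]; last by rewrite !ffunE (hr.2 j l) scalemxAr.
  rewrite !ffunE mxE; apply: (regular_at_divide (c' := c')) hy y0 cop (hr.1 _ _ _ Uq) _.
  rewrite -ef'; have := hu.1 j b q Uq; rewrite eu !ffunE mxE; exact.
- by rewrite scalerA divff ?scale1r.
- rewrite eu ef'; exact: (esym (scalerA _ _ r)).
Qed.
End Sections.

(** * Semistability bounds the degree of a section *)
(** The sum over ['S_3] of [d (s i)] does not depend on [i]; summing over [i]
    gives three times its value on one side, and the sum of [d] over all
    indices, once for each of the six permutations, on the other. *)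
Lemma inter3_hpol (d : cls) : inter3 d hpol hpol = 2 * \sum_i d i.
Proof.
have hpolE j : hpol j = 1.
  rewrite /hpol sum_ffunE (bigD1 j) //= ffunE eqxx big1 ?addr0 // => i ne.
  by rewrite ffunE eq_sym (negbTE ne).
pose M i := \sum_(s : 'S_3) d (s i).
have ME i j : M i = M j.
  rewrite /M (reindex_inj (mulgI (tperm i j))) /=.
  by apply: eq_bigr => s _; rewrite permM tpermL.
have -> : inter3 d hpol hpol = M (inord 0).
  by apply: eq_bigr => s _; rewrite !hpolE !mulr1.
have : \sum_i M i = 3%:R * M (inord 0).
  rewrite (eq_bigr (fun _ => M (inord 0))) => [|i _]; last exact: ME.
  by rewrite sumr_const card_ord mulr_natl.
rewrite exchange_big /= (eq_bigr (fun _ => \sum_i d i)) => [|s _]; last first.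
  by rewrite [RHS](reindex_inj (@perm_inj _ s)).
rewrite sumr_const card_Sn -mulr_natl (_ : 3`! = 6)%N //.
by move: (M _) (\sum_i _) => x y; lia.
Qed.

Section RankOne.
Variable k : closedFieldType.
Notation S := {mpoly k[3 * 2]}.
Notation K := {fraction {mpoly k[3 * 2]}}.
Notation pt := 'M[k]_(3, 2).

(** Local generators of [O(d)] at [p]. *)
Definition unit_at (d : cls) (p : pt) (g : K) :=
  [/\ g != 0, regular_at d p g & regular_at (- d) p g^-1].

Lemma unit_at1 p : unit_at 0 p 1.
Proof.
have h : regular_at 0 p (1 : K).
  by rewrite -(rmorph1 (@tofrac S)) -mpolyC1; apply/regular_at_poly/mhomogC.
by split; rewrite ?oner_neq0 ?oppr0 ?invr1.
Qed.

Lemma unit_atM d e p g h : unit_at d p g -> unit_at e p h ->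
  unit_at (d + e) p (g * h).
Proof.
move=> [g0 rg rg'] [h0 rh rh']; have gh0 := mulf_neq0 g0 h0.
split; first exact: gh0.
  exact: regular_atM.
by rewrite opprD invfM; apply: regular_atM.
Qed.

Lemma unit_atV d p g : unit_at d p g -> unit_at (- d) p g^-1.
Proof. by move=> [g0 rg rg']; split; rewrite ?invr_eq0 ?invrK ?opprK. Qed.

Lemma unit_atXz d p g (n : int) : unit_at d p g -> unit_at (d *~ n) p (g ^ n).
Proof.
move=> ug; have un m : unit_at (d *+ m) p (g ^+ m).
  elim: m => [|m IH]; first exact: unit_at1.
  by rewrite mulrS exprS; apply: unit_atM.
case: n => n; first exact: un.
exact: (unit_atV (un n.+1)).
Qed.

(** The generator of [O(d)] on the chart [c]; the exponents [d i] may be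
    negative. *)
Definition chart_monomial (c : {ffun 'I_3 -> 'I_2}) (d : cls) : K :=
  \prod_i (tofrac ('X_(mxvec_index i (c i)) : S)) ^ (d i).

Lemma chart_monomial_unit c d p : chart c p -> unit_at d p (chart_monomial c d).
Proof.
move=> [_ pc].
have ed : d = \sum_i hcl i *~ d i.
  apply/ffunP=> j; rewrite sum_ffunE (bigD1 j) //= big1 ?addr0 => [|i ne].
    by rewrite ffunMzE ffunE eqxx -mulrzr mul1r intz.
  by rewrite ffunMzE ffunE eq_sym (negbTE ne) mul0rz.
rewrite {1}ed /chart_monomial.
elim/big_rec2: _ => [|i g e _ IH]; first exact: unit_at1.
apply: unit_atM IH; apply: unit_atXz.
have hX := @mhomogX k i (c i); have eX : ev 'X_(mxvec_index i (c i)) p != 0.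
  by rewrite evX.
split; first by rewrite tofrac_eq0; apply: ev_neq0 eX.
  exact: regular_at_poly.
exact: regular_at_inv.
Qed.

Lemma chart_open c : is_open (@chart k c).
Proof.
split.
  by exists (const_mx 1); split=> [|i]; [exact: is_pt1|rewrite mxE oner_neq0].
exists (fun f => f = \prod_i 'X_(mxvec_index i (c i))); split.
  move=> _ ->; exists (\sum_i hcl i).
  elim/big_rec2: _ => [|i d f _ IH]; first by rewrite -mpolyC1; apply: mhomogC.
  exact/mhomogM/IH/mhomogX.
have evE p : ev (\prod_i 'X_(mxvec_index i (c i))) p = \prod_i p i (c i).
  by rewrite /ev rmorph_prod; apply: eq_bigr => i _; exact: evX.
move=> p; split=> [[pp pc]|[pp [_ ->]]].
  by split=> //; eexists; first reflexivity; rewrite evE; apply/prodf_neq0.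
by rewrite evE => /prodf_neq0 h; split=> // i; apply: h.
Qed.

Lemma chart_cover p : is_pt p -> exists c, @chart k c p.
Proof.
move=> pp; have h i : exists a, p i a != 0.
  by have /rV0Pn[a] := pp i; rewrite mxE; exists a.
have [c hc] := choice h; exists [ffun i => c i].
by split=> // i; rewrite ffunE.
Qed.

Lemma allX_open : is_open (@allX k).
Proof.
split; first by exists (const_mx 1); apply: is_pt1.
exists (fun f => f = 1); split.
  by move=> _ ->; exists 0; rewrite -mpolyC1; apply: mhomogC.
move=> p; split=> [pp|[]//]; split=> //.
by exists 1; rewrite // /ev meval1 oner_neq0.
Qed.

Lemma allX_big_open : big_open (@allX k).
Proof. by split; [exact: allX_open|move=> d f hf d0 _; apply: exists_zero hf d0]. Qed.

Variables (n : nat) (E : vbundle k n).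
Notation Vect := {ffun idx E -> 'cV[K]_n}.
Variables (c : cls) (r : Vect).
Hypotheses (hr : sections c (@allX k) r) (r0 : r != 0).

(** The image of the map [O(- c) -> E] given by the section [r] of [E(c)].  It
    need not be saturated in [E], but it is isomorphic to [O(- c)] on all of
    [X], so that its first Chern class is immediate. *)
Definition line_subsheaf (U : pt -> Prop) (s : Vect) :=
  exists2 f, regular (- c) U f & s = f *: r.

Lemma open_pt (U : pt -> Prop) p : is_open U -> U p -> is_pt p.
Proof. by move=> [_ [T [_ /(_ p)/iffLR h]]] /h []. Qed.

Lemma line_subsheaf_inj (f g : K) : f *: r = g *: r -> f = g.
Proof.
by move/eqP; rewrite -subr_eq0 -scalerBl scaler_eq0 (negbTE r0) orbF subr_eq0 => /eqP.
Qed.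

Lemma line_subsheaf_coherent : coh_subsheaf line_subsheaf.
Proof.
split.
- move=> U s oU [f rf ->]; rewrite -(addNr c); apply: sectionsZ.
    by move=> i p [Up _]; apply: rf.
  split; last exact: hr.2.
  by move=> i a p [Up dp]; apply: hr.1; split=> //; apply: open_pt oU Up.
- by move=> U _; exists 0; [move=> p _; apply: regular_at0|rewrite scale0r].
- move=> U s t oU [f rf ->] [g rg ->]; exists (f + g); last by rewrite scalerDl.
  by move=> p Up; apply: regular_atD; [apply: rf|apply: rg].
- move=> U f s _ rf [g rg ->]; exists (f * g); last by rewrite scalerA.
  by move=> p Up; rewrite -[- c]add0r; apply: regular_atM; [apply: rf|apply: rg].
- by move=> U W s _ _ WU [f rf ->]; exists f => // p /WU /rf.
- move=> U s [[p0 Up0] _] loc.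
  have [_ [_ _ _ [f _ ef]]] := loc p0 Up0; exists f => // p Up.
  have [W [_ Wp _ [g rg eg]]] := loc p Up.
  have -> : f = g by apply: line_subsheaf_inj; rewrite -ef -eg.
  exact: rg.
- move=> p /chart_cover[x xp]; have um := chart_monomial_unit (- c).
  exists (chart x), 1%N, (fun _ => chart_monomial x (- c) *: r); split=> //.
  + exact: chart_open.
  + by move=> _; exists (chart_monomial x (- c)) => // q /um[].
  move=> U s q oU Ux [f rf ->] Uq.
  exists U, (fun _ => f / chart_monomial x (- c)); split=> //.
    move=> _ y Uy; have [_ _ h] := um _ _ (Ux _ Uy).
    by rewrite -(subrr (- c)); apply: regular_atM h; apply: rf.
  have [g0 _ _] := um _ _ (Ux _ Uq).
  by rewrite big_ord1 scalerA divfK.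
Qed.

Lemma line_subsheaf_rank : sub_rank line_subsheaf 1.
Proof.
have [x xp] := chart_cover (@is_pt1 k); have um := chart_monomial_unit (- c).
have [g0 /regular_at_homog_fraction hg _] := um _ _ xp.
exists (fun _ => chart_monomial x (- c) *: r); split.
- move=> _; exists (chart x); first exact: chart_open.
  by exists (chart_monomial x (- c)) => // q /um[].
- move=> a _; rewrite big_ord1 => /eqP.
  by rewrite !scaler_eq0 (negbTE g0) (negbTE r0) !orbF => /eqP e j; rewrite ord1.
move=> s [U [[p Up] _] [f rf ->]].
exists (fun _ => f / chart_monomial x (- c)); last by rewrite big_ord1 scalerA divfK.
move=> _; have [e [a [b [ha hb b0 ->]]]] :=
  homog_fraction_div (regular_at_homog_fraction (rf p Up)) hg g0.
by exists e, a, b; split=> //; move: ha; rewrite subrr add0r.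
Qed.

Lemma line_subsheaf_c1 : sub_c1 line_subsheaf (- c).
Proof.
exists (@allX k), (fun f => f *: r); split; first exact: allX_big_open.
move=> U oU _; split.
- by move=> f rf; exists f.
- by move=> a f g _ _ _; rewrite scalerDl scalerA.
- by move=> f g _ _; apply: line_subsheaf_inj.
- by move=> s [f rf ->]; exists f.
Qed.
End RankOne.

Section Instanton.
Variables (k : closedFieldType) (E : vbundle k 2).
Hypothesis hE : instanton E.
Notation K := {fraction {mpoly k[3 * 2]}}.

(** The subsheaf [O(- c)] generated by [r] has slope at most zero. *)
Lemma instanton_degree_ge0 c (r : {ffun idx E -> 'cV[K]_2}) :
  sections c (@allX k) r -> r != 0 -> 0 <= \sum_i c i.
Proof.
move=> hr r0.
have := instanton_semistable hE (line_subsheaf_coherent hr r0)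
  (line_subsheaf_rank c r0) (line_subsheaf_c1 c r0) (instanton_c1 hE).
rewrite /slope !inter3_hpol.
rewrite [X in _ <= (_ * X)%:~R / _]big1 ?mulr0 ?mul0r => [|i _]; last by rewrite ffunE.
rewrite divr1 lerz0 (eq_bigr (fun i => - c i)) => [|i _]; last by rewrite ffunE.
rewrite sumrN; move: (\sum_i _) => x; lia.
Qed.

End Instanton.

(** * Dimension and forms of low degree *)
Section Dimension.
Variables (K : fieldType) (V : lmodType K) (L : K -> Prop) (A : V -> Prop).

Definition independent m (b : 'I_m -> V) :=
  (forall j, A (b j)) /\ forall c : 'I_m -> K, (forall j, L (c j)) ->
    \sum_j c j *: b j = 0 -> forall j, c j = 0.

(** An independent family of maximal size spans. *)
Lemma has_dim_of_bound N :
  (forall x y, L x -> L y -> L (- (x / y))) ->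
  ~ (exists b : 'I_N.+1 -> V, independent b) ->
  exists2 n, has_dim L A n & (n <= N)%N.
Proof.
move=> LC; elim: N => [|N IH] nind.
  exists 0%N => //; exists (fun _ => 0); split=> [[]//|? ? ? []//|v Av].
  exists (fun _ => 0); first by case.
  rewrite big_ord0; apply: contrapT => v0; apply: nind.
  exists (fun _ => v); split=> // c _; rewrite big_ord1 => /eqP.
  rewrite scaler_eq0 => /orP[/eqP c0 j|/eqP//]; by rewrite ord1.
have [[b [Ab ib]]|nb] := pselect (exists b : 'I_N.+1 -> V, independent b); last first.
  by have [n hn le] := IH nb; exists n => //; apply: leqW.
exists N.+1 => //; exists b; split=> // v Av.
pose b' (j : 'I_N.+2) := if unlift ord0 j is Some l then b l else v.
have b'0 : b' ord0 = v by rewrite /b' unlift_none.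
have b'S l : b' (lift ord0 l) = b l by rewrite /b' liftK.
have : ~ independent b' by move=> h; apply: nind; exists b'.
move=> /not_andP[[]|].
  by move=> j; rewrite /b'; case: unliftP.
move=> /existsNP[c /not_implyP[Lc /not_implyP[e /existsNP[j0 cj0]]]].
rewrite big_ord_recl b'0 (eq_bigr _ (fun l _ => congr1 _ (b'S l))) in e.
have c0 : c ord0 != 0.
  apply/eqP => c0; apply: cj0; rewrite c0 scale0r add0r in e.
  case: (unliftP ord0 j0) => [l|] -> //.
  exact: (ib (fun l => c (lift ord0 l)) _ e).
exists (fun l => - (c (lift ord0 l) / c ord0)); first by move=> l; apply: LC.
apply: (scalerI c0); move/eqP: e; rewrite addr_eq0 => /eqP ->.
rewrite scaler_sumr -sumrN; apply: eq_bigr => l _.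
by rewrite scalerA mulrN mulrC divfK // scaleNr.
Qed.
End Dimension.

Section LowDegree.
Variable k : closedFieldType.
Notation S := {mpoly k[3 * 2]}.
Notation K := {fraction {mpoly k[3 * 2]}}.
Notation X_ i a := ('X_(mxvec_index i a) : S).
Implicit Types (d e : cls) (a f g : S).

(** Every monomial of [f] is divisible by a coordinate of the [j]-th factor. *)
Lemma mhomog_split d f j : mhomog d f -> 0 < d j -> exists f0 f1,
  [/\ mhomog (d - hcl j) f0, mhomog (d - hcl j) f1
    & f = X_ j 0 * f0 + X_ j 1 * f1].
Proof.
move=> hf dj; rewrite (mpolyE f) big_seq.
elim/big_ind: _ => [|f1 f2 [p0 [p1 [h0 h1 ->]]] [q0 [q1 [g0 g1 ->]]]|m ms].
- by exists 0, 0; split; rewrite ?mulr0 ?addr0 //; apply: mhomog0.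
- by exists (p0 + q0), (p1 + q1); split; [exact: mhomogD..|ring].
have [b mb] : exists b, m (mxvec_index j b) != 0%N.
  apply: contrapT => h; move: dj; rewrite -(hf m ms j) big1 // => b _.
  by apply/eqP; apply: contrapT => /negP mb; apply: h; exists b.
have em : 'X_[m] = X_ j b * 'X_[m - U_(mxvec_index j b)].
  rewrite -mpolyXD addmC submK //.
  by apply/mnm_lepP => l; rewrite mnm1E; case: eqP => // <-; rewrite lt0n.
have hm : mhomog (d - hcl j) (f@_m *: 'X_[m - U_(mxvec_index j b)]).
  apply: mhomogZ; apply: (mhomog_cancel _ (@mhomogX k j b)).
    by rewrite -msupp_eq0 msuppX.
  by rewrite -em => m' /mem_msuppXP <-; apply: hf.
move: hm; set q := _ *: _ => hm.
have {}em : f@_m *: 'X_[m] = X_ j b * q by rewrite em -scalerAr.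
have : (b == 0) || (b == 1) by case: (b) => [[|[|]]].
case/orP=> /eqP eb; rewrite em eb; [exists q, 0|exists 0, q];
  by split; rewrite ?mulr0 ?addr0 ?add0r //; apply: mhomog0.
Qed.

Lemma linear_form i f : mhomog (hcl i) f ->
  exists x y : k, f = x *: X_ i 0 + y *: X_ i 1.
Proof.
move=> hf; have [|f0 [f1 []]] := mhomog_split (j := i) hf.
  by rewrite ffunE eqxx.
rewrite subrr => /mhomog_const[x ->] /mhomog_const[y ->] ->.
by exists x, y; rewrite -!mul_mpolyC; congr (_ + _); apply: mulrC.
Qed.

Lemma quadratic_form i f : mhomog (hcl i + hcl i) f ->
  exists x y z : k, f = x *: X_ i 0 ^+ 2 + y *: (X_ i 0 * X_ i 1) + z *: X_ i 1 ^+ 2.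
Proof.
move=> hf; have [|f0 [f1 []]] := mhomog_split (j := i) hf.
  by rewrite !ffunE eqxx.
rewrite addrK => /linear_form[x [y ->]] /linear_form[z [t ->]] ->.
by exists x, (y + z), t; rewrite -!mul_mpolyC mpolyCD; ring.
Qed.

(** Such a [d] is zero or a class [h_j], so the forms are constants or linear
    forms in two variables. *)
Lemma low_degree_span d : (forall j, 0 <= d j) -> \sum_j d j <= 1 ->
  exists g0 g1 : S, forall f, mhomog d f ->
  exists x y : k, f = x *: g0 + y *: g1.
Proof.
move=> d0 d1; have [[j dj]|nd] := pselect (exists j, d j != 0); last first.
  exists 1, 0 => f; have -> : d = 0.
    apply/ffunP=> j; rewrite ffunE; apply: contrapT => /eqP dj.
    by apply: nd; exists j.
  move=> /mhomog_const[x ->]; exists x, 0.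
  by rewrite scaler0 addr0 -mul_mpolyC mulr1.
have ed : d = hcl j.
  move: d1; rewrite (bigD1 j) //= => d1.
  have dj1 : 1 <= d j by rewrite -gtz0_ge1 lt_def dj d0.
  have s0 : 0 <= \sum_(i | i != j) d i by apply: sumr_ge0.
  have /eqP : \sum_(i | i != j) d i = 0.
    by move: (\sum_(i | _) _) d1 dj1 s0 => x; move: (d j) => y; lia.
  rewrite psumr_eq0 // => /allP h.
  have dj2 : d j = 1.
    by move: (\sum_(i | _) _) d1 dj1 s0 => x; move: (d j) => y; lia.
  apply/ffunP=> i; rewrite ffunE; case: eqP => [->|/eqP ne] //.
  by have /implyP/(_ ne)/eqP := h i (mem_index_enum i).
by exists (X_ j 0), (X_ j 1); rewrite ed => f; apply: linear_form.
Qed.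

Lemma three_vectors_dependent (x y : 'I_3 -> k) : exists c : 'I_3 -> k,
  [/\ exists j, c j != 0, \sum_j c j * x j = 0 & \sum_j c j * y j = 0].
Proof.
pose A : 'M[k]_(3, 2) := \matrix_(j, a) if a == 0 then x j else y j.
have /rowV0Pn[v /sub_kermxP vA v0] : kermx A != 0.
  rewrite -mxrank_eq0 mxrank_ker subn_eq0 -ltnNge.
  exact: leq_ltn_trans (rank_leq_col _) _.
exists (fun j => v 0 j); split; first by apply/rV0Pn.
  have /rowP/(_ 0) := vA; rewrite !mxE => vA0; rewrite -[RHS]vA0.
  by apply: eq_bigr => j _; rewrite mxE.
have /rowP/(_ 1) := vA; rewrite !mxE => vA0; rewrite -[RHS]vA0.
by apply: eq_bigr => j _; rewrite mxE.
Qed.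
End LowDegree.

(** * Sections of the twist by a fibre class *)
Section Wedge.
Variable K : fieldType.
Implicit Types u v w : 'cV[K]_2.

Definition wedge u v := u 0 0 * v 1 0 - u 1 0 * v 0 0.

Lemma det2 (M : 'M[K]_2) : \det M = M 0 0 * M 1 1 - M 0 1 * M 1 0.
Proof.
rewrite (expand_det_row _ 0) !big_ord_recl big_ord0 addr0 /cofactor !det_mx11 !mxE.
have -> : lift 0 0 = 1 :> 'I_2 by apply: val_inj.
have -> : lift 1 0 = 0 :> 'I_2 by apply: val_inj.
by rewrite /= addn0 expr0 mul1r expr1 mulN1r mulrN.
Qed.

Lemma wedge_mulmx (M : 'M[K]_2) u v : wedge (M *m u) (M *m v) = \det M * wedge u v.
Proof.
rewrite /wedge det2 !mxE !big_ord_recl !big_ord0 !addr0.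
have -> : lift 0 0 = 1 :> 'I_2 by apply: val_inj.
ring.
Qed.

(** Each coordinate is the expansion of a determinant of order three with rows
    [u, v, w] in which that coordinate is repeated as a third column. *)
Lemma wedge_Cramer u v w :
  wedge v w *: u + wedge w u *: v + wedge u v *: w = 0.
Proof.
apply/matrixP => a b; rewrite [b]ord1 !mxE /wedge.
have : (a == 0) || (a == 1) by case: (a) => [[|[|]]].
by case/orP => /eqP ->; ring.
Qed.

Lemma wedge_proportional u v (a : 'I_2) : u a 0 != 0 -> wedge u v = 0 ->
  v = (v a 0 / u a 0) *: u.
Proof.
move=> ua /eqP; rewrite subr_eq0 => /eqP e.
apply/matrixP => b c; rewrite [c]ord1 mxE.
apply: (mulIf ua); rewrite mulrAC divfK //.
have h1 x : (x == 0) || (x == 1 :> 'I_2) by case: x => [[|[|]]].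
case/orP: (h1 a) => /eqP ->; case/orP: (h1 b) => /eqP -> //.
  by rewrite mulrC e mulrC.
by rewrite mulrC -e mulrC.
Qed.
End Wedge.

Lemma sum_ord3 (V : nmodType) (F : 'I_3 -> V) :
  \sum_j F j = F 0 + F 1 + F 2%:R.
Proof.
rewrite !big_ord_recl big_ord0 addr0 addrA.
by congr (_ + F _ + F _); apply: val_inj.
Qed.

Lemma collect_coefficients (A : comPzRingType) (V : lmodType A) (p q r : A)
    (x1 x2 x3 y1 y2 y3 z1 z2 z3 : A) (u v w : V) :
  (x1 * p + y1 * q + z1 * r) *: u + (x2 * p + y2 * q + z2 * r) *: v
    + (x3 * p + y3 * q + z3 * r) *: w =
  p *: (x1 *: u + x2 *: v + x3 *: w) + q *: (y1 *: u + y2 *: v + y3 *: w)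
    + r *: (z1 *: u + z2 *: v + z3 *: w).
Proof.
rewrite !scalerDl !scalerDr !scalerA ![p * _]mulrC ![q * _]mulrC ![r * _]mulrC.
rewrite [X in X + _ = _]addrACA [LHS]addrACA; congr (_ + _).
by rewrite [X in X + _ = _]addrACA [LHS]addrACA.
Qed.

Section Instanton.
Variables (k : closedFieldType) (E : vbundle k 2).
Hypothesis hE : instanton E.
Notation S := {mpoly k[3 * 2]}.
Notation K := {fraction {mpoly k[3 * 2]}}.
Notation Vect := {ffun idx E -> 'cV[K]_2}.
Notation X_ i a := ('X_(mxvec_index i a) : S).
Notation "c %:K" := (tofrac (c%:MP : S)) (at level 2, format "c %:K").
Notation H0 d := (sections d (@allX k)).
Implicit Types (s t u : Vect) (d e : cls).

(** The functions [l j] trivialise [det E], so the quotients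
    [wedge (s j) (t j) / l j] agree over all trivialisations and form a single
    rational function, regular of degree [d + e] everywhere. *)
Lemma wedge_sections d e s t (l : idx E -> K) :
  (forall j, l j != 0 /\ regular 0 (dom j) (l j)^-1) ->
  (forall j j', l j = \det (trans j j') * l j') ->
  H0 d s -> H0 e t ->
  exists2 a, mhomog (d + e) a & forall j, wedge (s j) (t j) = tofrac a * l j.
Proof.
move=> l0 lE hs ht.
have [j0 _] := dom_cover E (@is_pt1 k).
pose w j := wedge (s j) (t j) / l j.
have wE j : w j = w j0.
  have [lj _] := l0 j; have [lj0 _] := l0 j0.
  have dj : \det (trans j j0) != 0.
    by apply: contra_neq lj => h; rewrite (lE j j0) h mul0r.
  rewrite /w (hs.2 j j0) (ht.2 j j0) wedge_mulmx (lE j j0).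
  by rewrite -mulf_div divff ?mul1r.
have [|a ha ea] := @global_regular k (d + e) (w j0).
  move=> p pp; have [j dj] := dom_cover E pp.
  have cj : cap (@allX k) (dom j) p by split.
  rewrite -(wE j) -[d + e]addr0; apply: regular_atM; last exact: (l0 j).2.
  apply: regular_atD; last apply: regular_atN.
    by apply: regular_atM; [apply: hs.1 cj|apply: ht.1 cj].
  by apply: regular_atM; [apply: hs.1 cj|apply: ht.1 cj].
by exists a => // j; rewrite -ea -(wE j) /w divfK //; case: (l0 j).
Qed.

(** [u] is divisible by the coordinate [X_ i a]: where it vanishes the other
    coordinate [X_ i b] does not, and there [u / X_ i a = v / X_ i b ^+ 2].  The
    quotient lies in [H^0(E)], which is zero. *)
Lemma coordinate_divides (i : 'I_3) (a b : 'I_2) u v : a != b ->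
  H0 (hcl i) u -> H0 (hcl i + hcl i) v ->
  tofrac (X_ i b ^+ 2) *: u = tofrac (X_ i a) *: v -> u = 0.
Proof.
move=> ab hu hv e.
have X0 c : tofrac (X_ i c) != 0 by rewrite tofrac_eq0 -msupp_eq0 msuppX.
suff /(instanton_H0 hE)/eqP : H0 0 ((tofrac (X_ i a))^-1 *: u).
  by rewrite scaler_eq0 invr_eq0 (negbTE (X0 a)) => /eqP.
split=> [j m p jp|j j']; last by rewrite !ffunE (hu.2 j j') scalemxAr.
rewrite !ffunE mxE.
have [pa|pa] := eqVneq (p i a) 0; last first.
  rewrite -(addNr (hcl i)); apply: regular_atM; last exact: hu.1 jp.
  by apply: regular_at_inv; [apply: mhomogX|rewrite evX].
have pb : p i b != 0.
  apply/eqP => pb; have /eqP := jp.1 i; apply; apply/rowP => c; rewrite !mxE.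
  have : (c == a) || (c == b).
    by move: ab; case: (a) => [[|[|]]] // ?; case: (b) => [[|[|]]] // ?;
      case: (c) => [[|[|]]].
  by case/orP => /eqP ->.
have -> : (tofrac (X_ i a))^-1 * u j m 0 = (tofrac (X_ i b ^+ 2))^-1 * v j m 0.
  have := congr1 (fun s : Vect => s j m 0) e; rewrite !ffunE !mxE => ej.
  apply: (mulfI (X0 a)); rewrite mulrA divff // mul1r.
  have b2 : tofrac (X_ i b ^+ 2) != 0 by rewrite rmorphXn expf_neq0 ?X0.
  by apply: (mulfI b2); rewrite ej mulrCA mulVKf.
rewrite -(addNr (hcl i + hcl i)); apply: regular_atM; last exact: hv.1 jp.
apply: regular_at_inv; first by rewrite expr2; apply: mhomogM; apply: mhomogX.
by rewrite expr2 evM evX mulf_neq0.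
Qed.

Lemma no_quadratic_relation (i : 'I_3) u v w :
  H0 (hcl i) u -> H0 (hcl i) v -> H0 (hcl i) w ->
  tofrac (X_ i 0 ^+ 2) *: u + tofrac (X_ i 0 * X_ i 1) *: v
    + tofrac (X_ i 1 ^+ 2) *: w = 0 ->
  [/\ u = 0, v = 0 & w = 0].
Proof.
move=> hu hv hw e.
have hX c s : H0 (hcl i) s -> H0 (hcl i + hcl i) (tofrac (X_ i c) *: s).
  by apply: sections_polyZ; apply: mhomogX.
have hN d s : H0 d s -> H0 d (- s).
  by rewrite -scaleN1r -(rmorph1 (@tofrac S)) -rmorphN -mpolyC1 -mpolyCN;
    apply: sections_constZ.
have w0 : w = 0.
  apply: (@coordinate_divides i 0 1 w
    (- (tofrac (X_ i 0) *: u + tofrac (X_ i 1) *: v))) => //.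
    by apply/hN/sectionsD; apply: hX.
  rewrite scalerN; apply/eqP; rewrite -addr_eq0 addrC; apply/eqP.
  by rewrite -[RHS]e scalerDr !scalerA -!rmorphM -expr2.
have u0 : u = 0.
  apply: (@coordinate_divides i 1 0 u
    (- (tofrac (X_ i 0) *: v + tofrac (X_ i 1) *: w))) => //.
    by apply/hN/sectionsD; apply: hX.
  rewrite scalerN; apply/eqP; rewrite -addr_eq0; apply/eqP.
  by rewrite -[RHS]e scalerDr !scalerA addrA -!rmorphM [X_ i 1 * X_ i 0]mulrC -expr2.
split=> //; apply/eqP; move/eqP: e; rewrite u0 w0 !scaler0 add0r addr0.
by rewrite scaler_eq0 tofrac_eq0 mulf_eq0 -!msupp_eq0 !msuppX.
Qed.

Definition dependent3 s1 s2 s3 := exists c1 c2 c3 : k,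
  [|| c1 != 0, c2 != 0 | c3 != 0] /\ c1%:K *: s1 + c2%:K *: s2 + c3%:K *: s3 = 0.

Lemma proportional_sections s t : s != 0 ->
  (forall j j', s j = trans j j' *m s j') -> (forall j j', t j = trans j j' *m t j') ->
  (forall j, wedge (s j) (t j) = 0) -> exists f : K, t = f *: s.
Proof.
move=> s0 hs ht st.
have [i [a sia]] : exists (i : idx E) (a : 'I_2), s i a 0 != 0.
  apply: contrapT => h; case/eqP: s0; apply/ffunP=> i; apply/colP=> a.
  rewrite ffunE mxE; apply/eqP; apply: contrapT => /negP ria.
  by apply: h; exists i, a.
exists (t i a 0 / s i a 0); apply/ffunP => j.
by rewrite (ht j i) ffunE (hs j i) scalemxAr -wedge_proportional.
Qed.

(** Removing common factors twice writes the three sections as multiples of a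
    section [r'] of [E(h_i - e - e')] by forms of degree [e + e'], and the
    degree bound leaves at most a two-dimensional space of such forms. *)
Lemma proportional_dependent (i : 'I_3) s1 s2 s3 :
  H0 (hcl i) s1 -> H0 (hcl i) s2 -> H0 (hcl i) s3 ->
  (forall j, wedge (s1 j) (s2 j) = 0) -> (forall j, wedge (s1 j) (s3 j) = 0) ->
  dependent3 s1 s2 s3.
Proof.
move=> h1 h2 h3 w2 w3.
have [s10|s10] := eqVneq s1 0.
  exists 1, 0, 0; split; first by rewrite oner_neq0.
  by rewrite s10 mpolyC0 rmorph0 !scale0r scaler0 !addr0.
have [f ef] := proportional_sections s10 h1.2 h2.2 w2.
have [g eg] := proportional_sections s10 h1.2 h3.2 w3.
have [e [a [b [r [hb ha hr eb ea]]]]] := common_factor h1 s10 h2 ef.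
rewrite subrr add0r in ha.
have r0 : r != 0 by apply: contra_neq s10 => h; rewrite eb h scaler0.
have eg' : s3 = (g * tofrac b) *: r by rewrite -scalerA -eb.
have [e' [x [y [r' [hy hx hr' ey ex]]]]] := common_factor hr r0 h3 eg'.
have r'0 : r' != 0 by apply: contra_neq r0 => h; rewrite ey h scaler0.
have {}hx : mhomog (e + e') x.
  by move: hx; congr mhomog; apply/ffunP => j; rewrite !ffunE; ring.
have eb' : s1 = tofrac (b * y) *: r' by rewrite eb ey scalerA -rmorphM.
have ea' : s2 = tofrac (a * y) *: r' by rewrite ea ey scalerA -rmorphM.
have by0 : b * y != 0.
  by apply: contra_neq s10 => h; rewrite eb' h rmorph0 scale0r.
have hby := mhomogM hb hy; have hay := mhomogM ha hy.
have [|g0 [g1 hg]] := @low_degree_span k (e + e') (fun j => mhomog_ge0 j by0 hby).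
  have := instanton_degree_ge0 hE hr' r'0.
  rewrite (eq_bigr (fun j => hcl i j - (e + e') j)) => [|j _]; last first.
    by rewrite !ffunE; ring.
  rewrite sumrB (bigD1 i) //= {1}ffunE eqxx [X in _ + X - _]big1 ?addr0.
    by rewrite subr_ge0.
  by move=> j ne; rewrite ffunE (negbTE ne).
have [[x1 [y1 E1]] [x2 [y2 E2]] [x3 [y3 E3]]] := And3 (hg _ hby) (hg _ hay) (hg _ hx).
have [c [[j cj] cx cy]] := three_vectors_dependent
  (fun j : 'I_3 => nth 0 [:: x1; x2; x3] j) (fun j : 'I_3 => nth 0 [:: y1; y2; y3] j).
exists (c 0), (c 1), (c 2%:R); split.
  have /or3P : [|| j == 0, j == 1 | j == 2%:R] by case: (j) => [[|[|[|]]]].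
  by case=> /eqP <-; rewrite cj ?orbT.
rewrite eb' ea' ex !scalerA -!scalerDl; apply/eqP; rewrite scaler_eq0 (negbTE r'0) orbF.
rewrite -!rmorphM -!rmorphD tofrac_eq0 E1 E2 E3.
move: cx cy; rewrite !sum_ord3 /= => cx cy; apply/eqP.
transitivity ((c 0 * x1 + c 1 * x2 + c 2%:R * x3) *: g0
  + (c 0 * y1 + c 1 * y2 + c 2%:R * y3) *: g1); last by rewrite cx cy !scale0r addr0.
by rewrite -!mul_mpolyC !mpolyCD !mpolyCM; ring.
Qed.

(** Cramer's identity, sorted by monomials in the two coordinates, is a
    quadratic relation between constant combinations of the sections. *)
Lemma sections_dependent (i : 'I_3) s1 s2 s3 :
  H0 (hcl i) s1 -> H0 (hcl i) s2 -> H0 (hcl i) s3 -> dependent3 s1 s2 s3.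
Proof.
move=> h1 h2 h3; apply: contrapT => ndep.
have [l [_ l0 lE]] := instanton_c1 hE.
have [a1 /quadratic_form[x1 [y1 [z1 e1]]] w1] := wedge_sections l0 lE h2 h3.
have [a2 /quadratic_form[x2 [y2 [z2 e2]]] w2] := wedge_sections l0 lE h3 h1.
have [a3 /quadratic_form[x3 [y3 [z3 e3]]] w3] := wedge_sections l0 lE h1 h2.
have cramer : tofrac a1 *: s1 + tofrac a2 *: s2 + tofrac a3 *: s3 = 0.
  apply/ffunP => j; rewrite !ffunE.
  apply: (scalerI (l0 j).1); rewrite scaler0 !scalerDr !scalerA.
  by rewrite ![l j * _]mulrC -w1 -w2 -w3 wedge_Cramer.
have hc (c1 c2 c3 : k) : H0 (hcl i) (c1%:K *: s1 + c2%:K *: s2 + c3%:K *: s3).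
  by do ?apply: sectionsD; apply: sections_constZ.
have [] := no_quadratic_relation (hc x1 x2 x3) (hc y1 y2 y3) (hc z1 z2 z3).
  by rewrite -collect_coefficients -[RHS]cramer e1 e2 e3 -!mul_mpolyC !rmorphD !rmorphM.
have indep c1 c2 c3 : c1%:K *: s1 + c2%:K *: s2 + c3%:K *: s3 = 0 ->
    [/\ c1 = 0, c2 = 0 & c3 = 0].
  move=> e; have /negP := (fun h => ndep (ex_intro _ c1 (ex_intro _ c2 (ex_intro _ c3 (conj h e))))).
  by rewrite !negb_or !negbK => /and3P[/eqP -> /eqP -> /eqP ->].
move=> /indep[x10 x20 x30] /indep[y10 y20 y30] /indep[z10 z20 z30].
apply/ndep/(proportional_dependent h1 h2 h3) => j.
  by rewrite w3 e3 x30 y30 z30 !scale0r !addr0 rmorph0 mul0r.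
have -> : wedge (s1 j) (s3 j) = - wedge (s3 j) (s1 j) by rewrite /wedge; ring.
by rewrite w2 e2 x20 y20 z20 !scale0r !addr0 rmorph0 mul0r oppr0.
Qed.

Lemma h0_hcl_le2 (i : 'I_3) : exists2 n : nat, h0_eq E (hcl i) n & (n <= 2)%N.
Proof.
apply: has_dim_of_bound.
  move=> _ _ [x ->] [y ->]; exists (- (x / y)).
  have [->|y0] := eqVneq y 0.
    have e0 : (0 : k)%:K = 0 by rewrite mpolyC0 rmorph0.
    rewrite e0 invr0 mulr0 oppr0 invr0 mulr0 oppr0; exact: esym e0.
  rewrite mpolyCN rmorphN; congr (- _).
  have yF : y%:K != 0 by rewrite tofrac_eq0 mpolyC_eq0.
  by apply: (mulIf yF); rewrite divfK // -rmorphM -mpolyCM divfK.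
move=> [b [hb ib]].
have [c1 [c2 [c3 [c0 e]]]] := sections_dependent (hb 0) (hb 1) (hb 2%:R).
pose c (j : 'I_3) := nth 0 [:: c1; c2; c3] j.
have c0' j : c j = 0.
  have : (c j)%:K = 0.
    apply: (ib (fun j => (c j)%:K)); first by move=> l; exists (c l).
    by rewrite sum_ord3.
  by move/eqP; rewrite tofrac_eq0 mpolyC_eq0 => /eqP.
move: c0; rewrite -[c1](_ : c 0 = _) // -[c2](_ : c 1 = _) // -[c3](_ : c 2%:R = _) //.
by rewrite !c0' eqxx.
Qed.
End Instanton.

Theorem proposition4p5 (R : realType) (E : vbundle R[i] 2) (hE : instanton E)
    (i : 'I_3) :
  exists2 n : nat, h0_eq E (hcl i) n & (n <= 2)%N.
Proof. exact: h0_hcl_le2. Qed.
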